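(* Let $A$ be an artinian local ring with infinite residue field, $S$ a finitely generated standard $\mathbb N^d$-graded algebra over $A$ and $M$ a finitely generated $\mathbb N^d$-graded $S$-module such that $S_{\mathbf 1}\not\subseteq\sqrt{\mathrm{Ann}_SM}$. Let $\mathbf k=(k_1,\dots,k_d)\in\mathbb N^d$ with $|\mathbf k|=\dim\mathrm{Supp}_{++}M$. Assume that $\mathbf x$ is an $S_{++}$-filter-regular sequence with respect to $M$ consisting of $k_1$ elements of $S_1,\dots,k_d$ elements of $S_d$. Then $e(M;\mathbf k)=\ell_A\big((M/\mathbf xM)_{\mathbf n}\big)$ for all large $\mathbf n$, and $e(M;\mathbf k)\neq0$ if and only if $\dim\mathrm{Supp}_{++}(M/\mathbf xM)=0$.
   Context: Notation: $\mathbf e_i$ unit vectors, $\mathbf 1=(1,\dots,1)$, $|\mathbf k|=\sum k_i$, $\mathbf k!=\prod k_i!$, $\mathbf n^{\mathbf k}=\prod n_i^{k_i}$; ''large $\mathbf n$'': $\mathbf n\ge\mathbf v$ componentwise for some $\mathbf v$. $S$ standard: $S_{\mathbf 0}=A$, generated by $S_i:=S_{\mathbf e_i}$; $S_{\mathbf 1}=S_{(1,\dots,1)}$, $S_{++}=\bigoplus_{\mathbf n\ge\mathbf 1}S_{\mathbf n}$; $\mathrm{Supp}_{++}M$ = homogeneous primes not containing $S_{++}$ at which $M$ localizes nonzero (dimension $-\infty$ if empty). With $s=\dim\mathrm{Supp}_{++}M$, $\ell_A(M_{\mathbf n})$ agrees for large $\mathbf n$ with a polynomial $P_M$ of degree $s$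 whose degree-$s$ part is $\sum_{|\mathbf k|=s}e(M;\mathbf k)\mathbf n^{\mathbf k}/\mathbf k!$ (mixed multiplicities). A homogeneous $a\in S$ is $S_{++}$-filter-regular with respect to $M$ if $(0_M:a)_{\mathbf n}=0$ for all large $\mathbf n$; homogeneous $x_1,\dots,x_t$ form an $S_{++}$-filter-regular sequence w.r.t. $M$ if each $x_i$ is $S_{++}$-filter-regular w.r.t. $M/(x_1,\dots,x_{i-1})M$. *)

(* Defs.v *)
From HB Require Import structures.
From mathcomp Require Import all_boot all_order all_algebra.
From mathcomp Require Import mpoly.
Set Implicit Arguments. Unset Strict Implicit. Unset Printing Implicit Defensive.
Import Order.TTheory GRing.Theory Num.Theory.
Local Open Scope ring_scope.

Definition deg (d : nat) := {ffun 'I_d -> nat}.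
Definition dadd d (m n : deg d) : deg d := [ffun i => (m i + n i)%N].
Definition dzero d : deg d := [ffun => 0%N].
Definition dunit d (i : 'I_d) : deg d := [ffun j => nat_of_bool (j == i)].
Definition dle d (m n : deg d) := forall i, (m i <= n i)%N.
Definition dabs d (k : deg d) : nat := (\sum_(i < d) k i)%N.

Definition incl (T : Type) (P Q : T -> Prop) := forall x, P x -> Q x.
Definition sincl (T : Type) (P Q : T -> Prop) := incl P Q /\ exists x, Q x /\ ~ P x.

Section Defs.
Variables (d : nat) (S : comNzRingType) (M : lmodType S).

Definition addgrp (V : zmodType) (P : V -> Prop) :=
  P 0 /\ (forall x y, P x -> P y -> P (x + y)) /\ (forall x, P x -> P (- x)).

Definition dirsum (V : zmodType) (F : deg d -> V -> Prop) :=
  (forall n, addgrp (F n)) /\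
  (forall v, exists ls : seq (deg d * V),
      (forall p, p \in ls -> F p.1 p.2) /\ v = \sum_(p <- ls) p.2) /\
  (forall ls : seq (deg d * V), uniq (map fst ls) ->
      (forall p, p \in ls -> F p.1 p.2) -> \sum_(p <- ls) p.2 = 0 ->
      forall p, p \in ls -> p.2 = 0).

(* N^d-graded ring structure on S, with A = S_0 *)
Definition graded_ring (Sg : deg d -> S -> Prop) :=
  dirsum Sg /\ Sg (dzero d) 1 /\
  (forall m n a b, Sg m a -> Sg n b -> Sg (dadd m n) (a * b)).

Definition subring_containing (B G R : S -> Prop) :=
  R 1 /\ (forall x y, R x -> R y -> R (x - y)) /\ (forall x y, R x -> R y -> R (x * y))
  /\ incl B R /\ incl G R.
Definition generates (B G : S -> Prop) :=
  forall R, subring_containing B G R -> forall s, R s.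

Definition fg_standard (Sg : deg d -> S -> Prop) :=
  graded_ring Sg /\
  generates (Sg (dzero d)) (fun s => exists i, Sg (dunit i) s) /\
  exists g : seq S, generates (Sg (dzero d)) (fun s => s \in g).

Definition idealA (Sg : deg d -> S -> Prop) (I : S -> Prop) :=
  incl I (Sg (dzero d)) /\ addgrp I /\
  (forall a x, Sg (dzero d) a -> I x -> I (a * x)).

Definition artinian_local_infres (Sg : deg d -> S -> Prop) :=
  (forall f : nat -> S -> Prop, (forall i, idealA Sg (f i)) ->
     (forall i, incl (f i.+1) (f i)) -> exists N, forall i, (N <= i)%N -> incl (f i) (f i.+1))
  /\ exists mm : S -> Prop,
     idealA Sg mm /\ ~ mm 1 /\
     (forall I, idealA Sg I -> ~ I 1 -> incl I mm) /\
     (forall s : seq S, exists a, Sg (dzero d) a /\ forall b, b \in s -> ~ mm (a - b)).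

Definition fg_graded_module (Sg : deg d -> S -> Prop) (Mg : deg d -> M -> Prop) :=
  dirsum Mg /\
  (forall m n a v, Sg m a -> Mg n v -> Mg (dadd m n) (a *: v)) /\
  exists g : seq M, forall v, exists cs : seq S,
      size cs = size g /\ v = \sum_(j < size g) cs`_j *: g`_j.

Definition S1_not_in_rad_ann (Sg : deg d -> S -> Prop) :=
  exists s, Sg [ffun => 1%N] s /\ forall e : nat, exists v : M, s ^+ e *: v <> 0.

Definition gen_sub (ys : seq S) : M -> Prop :=
  fun v => exists ms : seq M, size ms = size ys /\
     v = \sum_(j < size ys) ys`_j *: ms`_j.

Definition submodA (Sg : deg d -> S -> Prop) (K : M -> Prop) :=
  addgrp K /\ forall a v, Sg (dzero d) a -> K v -> K (a *: v).

(* chains K_0 < K_1 < ... of A-submodules with N cap H <= K_j <= H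
   (= chains of A-submodules of the quotient H / (N cap H)) *)
Definition qchain (Sg : deg d -> S -> Prop) (N H : M -> Prop) (c : seq (M -> Prop)) :=
  (forall j, (j < size c)%N -> submodA Sg (nth H c j) /\
       incl (fun v => N v /\ H v) (nth H c j) /\ incl (nth H c j) H) /\
  (forall j, (j.+1 < size c)%N -> sincl (nth H c j) (nth H c j.+1)).

Definition qlength (Sg : deg d -> S -> Prop) (N H : M -> Prop) (l : nat) :=
  (exists c, qchain Sg N H c /\ size c = l.+1) /\
  (forall c, qchain Sg N H c -> (size c <= l.+1)%N).

(* a is S_{++}-filter-regular w.r.t. M / N  (N a graded submodule) *)
Definition filter_regular (Sg : deg d -> S -> Prop) (Mg : deg d -> M -> Prop)
    (N : M -> Prop) (a : S) :=
  exists w : deg d, forall n, dle w n -> forall v, Mg n v -> N (a *: v) -> N v.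

Definition ideal (P : S -> Prop) :=
  addgrp P /\ forall a x, P x -> P (a * x).
Definition homog_prime (Sg : deg d -> S -> Prop) (P : S -> Prop) :=
  ideal P /\ ~ P 1 /\ (forall a b, P (a * b) -> P a \/ P b) /\
  (forall s, P s -> forall ls : seq (deg d * S), uniq (map fst ls) ->
      (forall p, p \in ls -> Sg p.1 p.2) -> s = \sum_(p <- ls) p.2 ->
      forall p, p \in ls -> P p.2).

(* Supp_{++} (M / N): homogeneous primes not containing S_{++} where
   (M/N)_P <> 0 *)
Definition supp_pp (Sg : deg d -> S -> Prop) (N : M -> Prop) (P : S -> Prop) :=
  homog_prime Sg P /\
  ~ (forall n : deg d, (forall i, (1 <= n i)%N) -> incl (Sg n) P) /\
  exists v : M, forall s, ~ P s -> ~ N (s *: v).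

Definition pchain (X : (S -> Prop) -> Prop) (c : seq (S -> Prop)) :=
  (forall j, (j < size c)%N -> X (nth (fun _ => False) c j)) /\
  (forall j, (j.+1 < size c)%N ->
      sincl (nth (fun _ => False) c j) (nth (fun _ => False) c j.+1)).
Definition dim_eq (X : (S -> Prop) -> Prop) (s : nat) :=
  (exists c, pchain X c /\ size c = s.+1) /\
  (forall c, pchain X c -> (size c <= s.+1)%N).

Definition hilbert_poly (Sg : deg d -> S -> Prop) (Mg : deg d -> M -> Prop)
    (P : {mpoly rat[d]}) :=
  exists w : deg d, forall n, dle w n -> exists l : nat,
     qlength Sg (gen_sub [::]) (Mg n) l /\
     (l%:R : rat) = P.@[fun i => ((n i)%:R : rat)].

End Defs.

Definition mixed_mult d (P : {mpoly rat[d]}) (k : deg d) : rat :=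
  ((\prod_(i < d) (k i)`!)%N)%:R * P@_[multinom k i | i < d].

(* Main.v *)
(** Multiplication by an [S_++]-filter-regular element [x] of [S_i] is injective on [M_n] for large
    [n], so passing from [M] to [M/xM] replaces the Hilbert function by its difference in the
    direction [i], up to a shift. After all of [xs] the length of [(M/xM)_n] is the [k]-th
    difference of the Hilbert polynomial, which is the constant [e(M;k)] because that polynomial
    has degree at most [|k| = dim Supp_++ M].

    The existence of the polynomial and the degree bound come together, by induction on the
    dimension of the support. Noetherian induction on [N] splits [M/N] into factors [N'/N]
    isomorphic to shifts of [S/P] with [P] a homogeneous prime. If [P] contains [S_++] the factor
    vanishes in large degrees; otherwise each [S_i] has an element outside [P], it acts injectively
    on [S/P], and the differences of the Hilbert function are Hilbert functions of modules with
    smaller support.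

    Finally, the constant is [0] iff the support is empty, and a chain [P0 < P1] in the support
    would make the length of [(S/P0)_n] unbounded, hence [e(M;k) <> 0] iff the support has
    dimension [0]. *)
Require Import Defs.
From HB Require Import structures.
From mathcomp Require Import all_boot all_order all_algebra.
From mathcomp Require Import mpoly.
From Stdlib Require Import Classical ClassicalEpsilon FunctionalExtensionality PropExtensionality.
Set Implicit Arguments. Unset Strict Implicit. Unset Printing Implicit Defensive.
Import Order.TTheory GRing.Theory Num.Theory.
Local Open Scope ring_scope.

(** Quotient modules are never formed. A factor [H/N] is a pair of predicates on one ambient module,
    and its length is that of a composition series from [N] to [H]. Lengths then add along
    inclusions with no isomorphism to transport; only multiplication by an element needs a
    correspondence of submodules. The finiteness behind this starts from the descending chain
    condition on ideals of [A]: it gives [A] finite length, the basis theorem then makes [S] and [M]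
    Noetherian, and each [M_n] has finite length. Polynomiality is stated through vanishing of
    iterated differences. This form is stable under sums, shifts and eventual equality, and it fits
    the induction, where one prime less in the chains is one difference less. A genuine polynomial
    is produced only afterwards. Its coefficient at [k] can be read off because the differences
    counted by [k] kill every other monomial of degree at most [|k|] and turn [n^k] into [k!]. *)

Lemma predext (T : Type) (P Q : T -> Prop) : incl P Q -> incl Q P -> P = Q.
Proof.
move=> PQ QP; apply: functional_extensionality => x.
by apply: propositional_extensionality; split; [exact: PQ | exact: QP].
Qed.

Lemma incl_refl (T : Type) (P : T -> Prop) : incl P P. Proof. by []. Qed.

Lemma incl_trans (T : Type) (P Q R : T -> Prop) : incl P Q -> incl Q R -> incl P R.
Proof. by move=> PQ QR x /PQ/QR. Qed.

Lemma not_incl (T : Type) (P Q : T -> Prop) : ~ incl P Q -> exists x, P x /\ ~ Q x.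
Proof.
by move=> /not_all_ex_not [x nPQ]; exists x; exact: imply_to_and nPQ.
Qed.

(** A point that is not accessible has a predecessor that is not accessible either; choosing one
    repeatedly gives an infinite descent. Both chain conditions below become induction principles
    this way. *)
Lemma wf_of_no_infinite_descent (T : Type) (R : T -> T -> Prop) :
  (forall f : nat -> T, ~ forall i, R (f i.+1) (f i)) -> well_founded R.
Proof.
move=> noinf x; apply: NNPP => nAx.
have step (y : {y | ~ Acc R y}) : {z : {z | ~ Acc R z} | R (sval z) (sval y)}.
  apply: constructive_indefinite_description.
  case: y => y nAy; suff [z [nAz Rzy]] : exists z, ~ Acc R z /\ R z y.
    by exists (exist _ z nAz).
  apply: NNPP => nz; apply: (nAy); constructor => z Rzy.
  by apply: NNPP => nAz; apply: nz; exists z.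
pose f := fix f n := if n is n'.+1 then sval (step (f n')) else exist _ x nAx.
by apply: (noinf (fun n => sval (f n))) => i; exact: (svalP (step (f i))).
Qed.

Definition cap (T : Type) (K L : T -> Prop) : T -> Prop := fun v => K v /\ L v.

(** * Submodules and length *)

Section Submodules.
Variables (S : comNzRingType) (V : lmodType S).
Implicit Types (B : S -> Prop) (K L N H : V -> Prop).

(** The scalars are a mere predicate, so one notion covers [A]-submodules ([B] of degree zero),
    [S]-submodules ([B] everything) and closure under a set of ring generators. *)
Definition submod B K := addgrp K /\ forall a v, B a -> K v -> K (a *: v).
Definition psum K L : V -> Prop := fun v => exists x y, [/\ K x, L y & v = x + y].
Definition pzero : V -> Prop := fun v => v = 0.
Definition multiples B (v : V) : V -> Prop := fun w => exists2 a, B a & w = a *: v.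
Definition lspan B (s : seq V) : V -> Prop :=
  foldr (fun v K => psum (multiples B v) K) pzero s.

Section Fix.
Variable B : S -> Prop.

Lemma submod0 K : submod B K -> K 0. Proof. by case=> [[]]. Qed.
Lemma submodD K x y : submod B K -> K x -> K y -> K (x + y).
Proof. by case=> [[_ []]] KD _ _; exact: KD. Qed.
Lemma submodN K x : submod B K -> K x -> K (- x).
Proof. by case=> [[_ []]] _ KN _; exact: KN. Qed.
Lemma submodB K x y : submod B K -> K x -> K y -> K (x - y).
Proof. by move=> sK Kx Ky; apply: submodD => //; exact: submodN. Qed.
Lemma submodZ K a x : submod B K -> B a -> K x -> K (a *: x).
Proof. by case=> _; apply. Qed.
Lemma submodDr K x y : submod B K -> K (x + y) -> K y -> K x.
Proof. by move=> sK Kxy Ky; rewrite -[x](addrK y); exact: submodB. Qed.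
Lemma submod_sum K (I : eqType) (r : seq I) (P : pred I) (F : I -> V) : submod B K ->
  (forall i, i \in r -> P i -> K (F i)) -> K (\sum_(i <- r | P i) F i).
Proof.
move=> sK KF; rewrite big_seq_cond; apply: (big_ind K); first exact: submod0.
- by move=> x y; exact: submodD.
- by move=> i /andP[]; exact: KF.
Qed.

Lemma submod_cap K L : submod B K -> submod B L -> submod B (cap K L).
Proof.
move=> sK sL; split; first split; first by split; exact: submod0.
- split=> [x y [Kx Lx] [Ky Ly]|x [Kx Lx]]; first by split; exact: submodD.
  by split; exact: submodN.
- by move=> a v Ba [Kv Lv]; split; exact: submodZ.
Qed.

Lemma submod_psum K L : submod B K -> submod B L -> submod B (psum K L).
Proof.
move=> sK sL; split; first split.
- by exists 0, 0; split; rewrite ?addr0 //; exact: submod0.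
- split=> [_ _ [x [y [Kx Ly ->]]] [x' [y' [Kx' Ly' ->]]]|_ [x [y [Kx Ly ->]]]].
    by exists (x + x'), (y + y'); split; [exact: submodD|exact: submodD|rewrite addrACA].
  by exists (- x), (- y); split; [exact: submodN|exact: submodN|rewrite opprD].
- move=> a _ Ba [x [y [Kx Ly ->]]].
  by exists (a *: x), (a *: y); split; [exact: submodZ|exact: submodZ|rewrite scalerDr].
Qed.

Lemma psum_incll K L : submod B L -> incl K (psum K L).
Proof. by move=> sL x Kx; exists x, 0; split; rewrite ?addr0 //; exact: submod0. Qed.

Lemma psum_inclr K L : submod B K -> incl L (psum K L).
Proof. by move=> sK x Lx; exists 0, x; split; rewrite ?add0r //; exact: submod0. Qed.

Lemma psum_least K L H : submod B H -> incl K H -> incl L H -> incl (psum K L) H.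
Proof. by move=> sH KH LH _ [x [y [/KH Hx /LH Hy ->]]]; exact: submodD. Qed.

Lemma submod_pzero : submod B pzero.
Proof.
split; first split; first by [].
- by split=> [x y -> ->|x ->]; rewrite /pzero ?addr0 ?oppr0.
- by move=> a v _ ->; rewrite /pzero scaler0.
Qed.

Lemma pzero_incl K : submod B K -> incl pzero K.
Proof. by move=> sK x ->; exact: submod0. Qed.

Hypothesis B1 : B 1.
Hypothesis BB : forall x y, B x -> B y -> B (x - y).
Hypothesis BM : forall x y, B x -> B y -> B (x * y).

Lemma submod_multiples v : submod B (multiples B v).
Proof.
have B0 : B 0 by rewrite -(subrr 1); exact: BB.
have BN x : B x -> B (- x) by rewrite -sub0r; exact: BB.
split; first split; first by exists 0; rewrite ?scale0r.
- split=> [_ _ [a Ba ->] [b Bb ->]|_ [a Ba ->]].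
    by exists (a + b); rewrite ?scalerDl // -[b]opprK; exact: BB (BN _ _).
  by exists (- a); rewrite ?scaleNr //; exact: BN.
- by move=> a _ Ba [b Bb ->]; exists (a * b); rewrite ?scalerA //; exact: BM.
Qed.

Lemma multiples_incl v K : submod B K -> K v -> incl (multiples B v) K.
Proof. by move=> sK Kv _ [a Ba ->]; exact: submodZ. Qed.

Lemma multiples_id v : multiples B v v.
Proof. by exists 1; rewrite ?scale1r. Qed.

Lemma submod_lspan s : submod B (lspan B s).
Proof.
elim: s => [|v s IH] /=; first exact: submod_pzero.
by apply: submod_psum IH; exact: submod_multiples.
Qed.

Lemma lspan_incl (s : seq V) K : submod B K -> (forall x, x \in s -> K x) -> incl (lspan B s) K.
Proof.
move=> sK; elim: s => [|v s IH] /= sP; first exact: (pzero_incl sK).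
apply: (psum_least sK); first by apply: (multiples_incl sK); apply: sP; rewrite inE eqxx.
by apply: IH => x xs; apply: sP; rewrite inE xs orbT.
Qed.

Lemma lspan_mem (s : seq V) x : x \in s -> lspan B s x.
Proof.
elim: s => [//|v s IH]; rewrite inE => /orP[/eqP ->|/IH h] /=.
  exact: (psum_incll (submod_lspan s) (multiples_id v)).
exact: (psum_inclr (submod_multiples v) h).
Qed.

End Fix.
End Submodules.

Arguments pzero {S V}.

(** * Composition series of factors [H/N] *)

Section Length.
Variables (S : comNzRingType) (B : S -> Prop).

Section OneModule.
Variable V : lmodType S.
Implicit Types (K L N H : V -> Prop).

Definition covers K H := sincl K H /\
  forall L, submod B L -> incl K L -> incl L H -> incl L K \/ incl H L.

(* [clen N H l] : there is a composition series of length [l] from [N] to [H]. *)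
Inductive clen N : (V -> Prop) -> nat -> Prop :=
| clen0 : clen N N 0
| clenS K H l : clen N K l -> submod B H -> covers K H -> clen N H l.+1.

Lemma clen_incl N H l : clen N H l -> incl N H.
Proof. by elim=> // K H' l' _ NK _ [[KH _] _]; exact: incl_trans KH. Qed.

Lemma clen_submod N H l : submod B N -> clen N H l -> submod B H.
Proof. by move=> sN []. Qed.

Lemma clen_trans N K H a b : clen N K a -> clen K H b -> clen N H (a + b).
Proof.
move=> NK; elim=> [|K' H' l' _ IH sH cov]; first by rewrite addn0.
by rewrite addnS; exact: clenS IH sH cov.
Qed.

Lemma clen0_eq N H : clen N H 0 -> N = H.
Proof. by move=> c; inversion c. Qed.

(** The second isomorphism theorem inside the lattice: [L/(L cap K)] is [(L + K)/K], which is the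
    simple factor [H/K]. Simplicity is applied to [T + K], and the modular law leads back to [T]. *)
Lemma covers_cap K H L : submod B K -> submod B L -> submod B H -> covers K H ->
  incl L H -> ~ incl L K -> covers (cap L K) L.
Proof.
move=> sK sL sH [[KH _] cov] LH nLK; split.
  split; first by move=> x [].
  by have [x [Lx nKx]] := not_incl nLK; exists x; split => // -[].
move=> T sT lT TL.
have sTK := submod_psum sT sK.
have [le|ge] := cov _ sTK (psum_inclr sT) (psum_least sH (incl_trans TL LH) KH).
  by left=> x Tx; split; [exact: TL | apply: le; exact: psum_incll sK _ Tx].
right=> x Lx; have [t [k [Tt Kk xE]]] := ge _ (LH _ Lx).
rewrite xE; apply: (submodD sT Tt); apply: lT; split=> //.
have -> : k = x - t by rewrite xE addrC addKr.
exact: submodB sL Lx (TL _ Tt).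
Qed.

(** Intersecting a composition series with [K] leaves each factor simple or makes it trivial. The
    strict bound for a proper [K] is the source of the uniqueness of lengths. *)
Lemma clen_sub N H l K : submod B N -> clen N H l -> submod B K -> incl N K -> incl K H ->
  exists l', [/\ clen N K l', (l' <= l)%N & ~ incl H K -> (l' < l)%N].
Proof.
move=> sN c; elim: c K => [|H' {}H {}l NH' IH sH cov] K.
  move=> sK NK KN; exists 0%N; rewrite (predext KN NK); split=> //; first exact: clen0.
  by case.
move=> sK NK KH; have sH' := clen_submod sN NH'.
have [KH'|nKH'] := classic (incl K H').
  by have [l' [cK le _]] := IH _ sK NK KH'; exists l'; split=> //; exact: leqW.
have sKH' := submod_cap sK sH'.
have [x Nx|x [] //|l' [c le lt]] := IH _ sKH'.
  by split; [exact: NK | exact: clen_incl NH' _ Nx].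
exists l'.+1; split=> //; first by apply: (clenS c sK _); exact: covers_cap sH' sK sH cov KH nKH'.
move=> nHK; apply: lt => H'K; apply: nHK.
have H'K' : incl H' K by move=> x /H'K [].
by case: (cov.2 _ sK H'K' KH).
Qed.

Lemma clen_le N H l l' : submod B N -> clen N H l -> clen N H l' -> (l' <= l)%N.
Proof.
move=> sN c c'; elim: c' l c => [//|K H' {}l' NK IH sH cov] l c.
have sK := clen_submod sN NK.
have [l1 [c1 _ lt]] := clen_sub sN c sK (clen_incl NK) cov.1.1.
apply: (leq_ltn_trans (IH _ c1) (lt _)) => HK.
by case: cov => [[_ [x [/HK]]]].
Qed.

Lemma clen_uniq N H l l' : submod B N -> clen N H l -> clen N H l' -> l = l'.
Proof.
by move=> sN c c'; apply/eqP; rewrite eqn_leq (clen_le sN c' c) (clen_le sN c c').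
Qed.

End OneModule.

(** A composition series depends only on the lattice of submodules between its ends. [phi] acts on
    predicates and need not come from a map, so that images and preimages are both instances. *)
Lemma clen_iso (U V : lmodType S) (phi : (U -> Prop) -> (V -> Prop)) N H l :
  submod B N -> clen N H l ->
  (forall K, submod B K -> incl N K -> incl K H -> submod B (phi K)) ->
  (forall K K', submod B K -> incl N K -> incl K H -> submod B K' -> incl N K' -> incl K' H ->
     (incl K K' <-> incl (phi K) (phi K'))) ->
  (forall L, submod B L -> incl (phi N) L -> incl L (phi H) ->
     exists K, [/\ submod B K, incl N K, incl K H & L = phi K]) ->
  clen (phi N) (phi H) l.
Proof.
move=> sN; elim=> [*|K {}H {}l NK IH sH [[KH [x [Hx nKx]]] cov] phiS phiI phiT].
  exact: clen0.
have NKi := clen_incl NK; have NHi := incl_trans NKi KH.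
have sK := clen_submod sN NK.
have HH := @incl_refl _ H; have KK := @incl_refl _ K.
have phiKH : incl (phi K) (phi H) by apply/(phiI K H).
apply: (clenS (K := phi K) _ (phiS _ sH NHi HH) _).
- apply: IH => [L sL NL LK|L L' sL NL LK sL' NL' LK'|L sL NL LK].
  + by apply: phiS => //; exact: incl_trans KH.
  + by apply: phiI => //; exact: incl_trans KH.
  + have [T [sT NT TH TE]] := phiT _ sL NL (incl_trans LK phiKH).
    by exists T; split=> //; apply/phiI => //; rewrite -TE.
- split; first split=> //.
  + by apply: not_incl => /(phiI H K) HK; apply: nKx; exact: HK.
  + move=> L sL KL LH.
    have NphiK : incl (phi N) (phi K) by apply/(phiI N K).
    have [T [sT NT TH TE]] := phiT _ sL (incl_trans NphiK KL) LH.
    have KT : incl K T by apply/(phiI K T) => //; rewrite -TE.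
    rewrite TE; have [TK|HT] := cov T sT KT TH; [left|right]; exact/phiI.
Qed.

Section LinearMaps.
Variables (U V : lmodType S) (f : U -> V).
Hypothesis fD : forall x y, f (x + y) = f x + f y.
Hypothesis fZ : forall a x, f (a *: x) = a *: f x.

Definition fimage (K : U -> Prop) : V -> Prop := fun v => exists2 u, K u & v = f u.
Definition fpreimage (H : U -> Prop) (L : V -> Prop) : U -> Prop := fun u => H u /\ L (f u).

Lemma map0 : f 0 = 0. Proof. by rewrite -(scale0r 0) fZ scale0r. Qed.
Lemma mapN x : f (- x) = - f x. Proof. by rewrite -scaleN1r fZ scaleN1r. Qed.
Lemma mapB x y : f (x - y) = f x - f y. Proof. by rewrite fD mapN. Qed.

Lemma submod_image K : submod B K -> submod B (fimage K).
Proof.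
move=> sK; split; first split; first by exists 0; [exact: submod0 sK|rewrite map0].
- split=> [_ _ [x Kx ->] [y Ky ->]|_ [x Kx ->]].
    by exists (x + y); rewrite ?fD //; exact: submodD sK _ _.
  by exists (- x); rewrite ?mapN //; exact: submodN sK _.
- by move=> a _ Ba [x Kx ->]; exists (a *: x); rewrite ?fZ //; exact: submodZ sK _ _.
Qed.

Lemma submod_preimage H L : submod B H -> submod B L -> submod B (fpreimage H L).
Proof.
move=> sH sL; split; first split.
- by split; rewrite ?map0; [exact: submod0 sH|exact: submod0 sL].
- split=> [x y [Hx Lx] [Hy Ly]|x [Hx Lx]].
    by split; rewrite ?fD; [exact: submodD sH _ _|exact: submodD sL _ _].
  by split; rewrite ?mapN; [exact: submodN sH _|exact: submodN sL _].
- by move=> a v Ba [Hv Lv]; split; rewrite ?fZ; [exact: submodZ sH _ _|exact: submodZ sL _ _].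
Qed.

Variables (N H : U -> Prop) (N' : V -> Prop).
Hypotheses (sN : submod B N) (sH : submod B H) (sN' : submod B N').
Hypothesis fN : forall v, H v -> (N' (f v) <-> N v).

Lemma psum_image_incl K K' : submod B K' -> incl N K' -> incl K' H -> incl K H ->
  incl (psum (fimage K) N') (psum (fimage K') N') -> incl K K'.
Proof.
move=> sK' NK' K'H KH le x Kx.
have [_ [y [[z K'z ->] N'y fxE]]] : psum (fimage K') N' (f x).
  by apply: le; exact: (psum_incll sN' (ex_intro2 _ _ x Kx erefl)).
rewrite -[x](subrK z); apply: (submodD sK' _ K'z); apply: NK'.
apply/fN; first exact: submodB sH (KH _ Kx) (K'H _ K'z).
by rewrite mapB fxE addrC addKr.
Qed.

Lemma psum_image_mono K K' : incl K K' -> incl (psum (fimage K) N') (psum (fimage K') N').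
Proof.
move=> KK' _ [_ [y [[z Kz ->] N'y ->]]]; exists (f z), y; split=> //.
by exists z => //; exact: KK'.
Qed.

(** By [fN], the map [f] embeds [H/N] into [V/N']. Submodules correspond through [K -> f(K) + N'],
    with inverse [L -> H cap f^-1(L)]. *)
Lemma clen_image l : incl N H -> clen N H l -> clen N' (psum (fimage H) N') l.
Proof.
move=> NH c.
have -> : N' = psum (fimage N) N'.
  apply: predext; first exact: psum_inclr (submod_image sN).
  by apply: (psum_least sN' _ (@incl_refl _ _)) => _ [u Nu ->]; apply/fN => //; exact: NH.
have -> : psum (fimage H) (psum (fimage N) N') = psum (fimage H) N'.
  apply: predext.
    apply: (psum_least (submod_psum (submod_image sH) sN') _ _).
      exact: psum_incll sN'.
    exact: psum_image_mono.
  move=> _ [x [y [Hx N'y ->]]]; exists x, y; split=> //.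
  exact: psum_inclr (submod_image sN) _ N'y.
apply: (@clen_iso U V (fun K => psum (fimage K) N') _ _ _ sN c).
- by move=> K sK _ _; exact: submod_psum (submod_image sK) sN'.
- move=> K K' sK NK KH sK' NK' KH'; split; first exact: psum_image_mono.
  exact: psum_image_incl.
- move=> L sL NL LH; exists (fpreimage H L).
  have N'L : incl N' L := incl_trans (psum_inclr (submod_image sN)) NL.
  split=> [||x []//|]; first exact: submod_preimage.
    move=> x Nx; split; first exact: NH.
    by apply: N'L; apply/fN => //; exact: NH.
  apply: predext => [x Lx|]; last first.
    by apply: (psum_least sL) => // _ [u [_ Lu] ->].
  have [_ [y [[z Hz ->] N'y xE]]] := LH _ Lx.
  exists (f z), y; split=> //; exists z => //; split=> //.
  by apply: (submodDr sL (y := y)); rewrite -?xE //; exact: N'L.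
Qed.

(** The same correspondence run backwards, for the case where finite length is known only on the
    side of the image. *)
Lemma clen_preimage l : incl N H -> clen N' (psum (fimage H) N') l -> clen N H l.
Proof.
move=> NH c.
have NE : N = fpreimage H N'.
  apply: predext => [x Nx|x [Hx /fN]]; last exact.
  by split; [exact: NH | apply/fN => //; exact: NH].
have HE : H = fpreimage H (psum (fimage H) N').
  apply: predext => [x Hx|x []//]; split=> //.
  by exact: (psum_incll sN' (ex_intro2 _ _ x Hx erefl)).
rewrite {1}NE {2}HE; apply: (@clen_iso V U (fpreimage H) _ _ _ sN' c).
- by move=> K sK _ _; exact: submod_preimage.
- move=> K K' sK NK KH sK' NK' KH'; split=> [KK' x [Hx Kx]|KK' x Kx].
    by split=> //; exact: KK'.
  have [_ [y [[z Hz ->] N'y xE]]] := KH _ Kx.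
  rewrite xE; apply: (submodD sK' _ (NK' _ N'y)).
  have [] // : fpreimage H K' z; apply: KK'; split=> //.
  by apply: (submodDr sK (y := y)); rewrite -?xE //; exact: NK.
- move=> L sL NL LH; exists (psum (fimage L) N').
  have LH' : incl L H by move=> x /LH [].
  split; first exact: submod_psum (submod_image sL) sN'.
  + exact: psum_inclr (submod_image sL).
  + exact: psum_image_mono.
  + apply: predext => [x Lx|x [Hx [_ [y [[z Lz ->] N'y fE]]]]].
      by split; [exact: LH' | exact: (psum_incll sN' (ex_intro2 _ _ x Lx erefl))].
    rewrite -[x](subrK z); apply: (submodD sL _ Lz); apply: NL.
    split; first exact: submodB sH Hx (LH' _ Lz).
    by rewrite mapB fE addrC addKr.
Qed.

End LinearMaps.

Section Quotients.
Variable V : lmodType S.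
Implicit Types K N H : V -> Prop.

(** If [K] is not inside the last proper term [H'], simplicity gives [H = H' + K], hence [H/K] is
    [H'/(K cap H')] and the induction applies. This isomorphism is [clen_image] for the identity
    map. *)
Lemma clen_quot N H l K : submod B N -> clen N H l -> submod B K -> incl N K -> incl K H ->
  exists l', clen K H l'.
Proof.
move=> sN c; elim: c K => [|H' {}H {}l NH' IH sH [[H'H nHH'] cov]] K.
  by move=> sK NK KN; exists 0%N; rewrite (predext NK KN); exact: clen0.
move=> sK NK KH; have sH' := clen_submod sN NH'.
have [KH'|nKH'] := classic (incl K H').
  by have [l' c] := IH _ sK NK KH'; exists l'.+1; apply: (clenS c sH _).
have sKH' := submod_cap sK sH'.
have [||l' c] := IH _ sKH'; [|by move=> x []|].
  by move=> x Nx; split; [exact: NK | exact: clen_incl NH' _ Nx].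
have HE : H = psum (fimage (@id V) H') K.
  apply: predext => [x Hx|]; last by apply: (psum_least sH) => // _ [u /H'H ? ->].
  have [|le|/(_ _ Hx) [y [z [Hy Kz ->]]]] := cov _ (submod_psum sH' sK) (psum_incll sK).
  - exact: (psum_least sH).
  - by case: nKH'; exact: incl_trans (psum_inclr sH') le.
  - by exists y, z; split=> //; exists y.
exists l'; rewrite HE; apply: (@clen_image V V id _ _ (cap K H') H' K) => // [v Hv|v []//].
by split=> [Kv|[]].
Qed.

End Quotients.
End Length.

(** * Agreement with the length defined by chains *)

Section QLength.
Variables (d : nat) (S : comNzRingType) (M : lmodType S) (Sg : deg d -> S -> Prop).
Local Notation B := (Sg (dzero d)).
Implicit Types N H K : M -> Prop.

Lemma clen_chain N H l : submod B N -> clen B N H l -> exists c : seq (M -> Prop),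
  [/\ size c = l.+1, nth H c l = H,
      forall j, (j < size c)%N -> [/\ submod B (nth H c j), incl N (nth H c j) & incl (nth H c j) H]
    & forall j, (j.+1 < size c)%N -> sincl (nth H c j) (nth H c j.+1)].
Proof.
move=> sN; elim=> [|K {}H {}l NK [c [sc cl cP cS]] sH [KH cov]].
  by exists [:: N]; split=> // -[|//] _; split=> //; exact: incl_refl.
exists (rcons c H); split=> [||j|j]; rewrite ?size_rcons ?sc //.
- by rewrite nth_rcons sc ltnn eqxx.
- move=> lt; rewrite nth_rcons sc; case: ltnP => [lt'|ge].
    rewrite (set_nth_default K) ?sc //; have [|s1 s2 s3] := cP j; rewrite ?sc //.
    by split=> //; exact: incl_trans KH.1.
  rewrite if_same; split=> //; apply: incl_trans KH.1; exact: clen_incl NK.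
- move=> lt; rewrite !nth_rcons sc -ltnS lt; case: ltnP => [lt'|ge].
    rewrite (set_nth_default K H) ?sc ?(ltnW lt') //.
    by rewrite (set_nth_default K H (n := j.+1)) ?sc //; apply: cS; rewrite sc.
  have -> : j = l by apply/eqP; rewrite eqn_leq; apply/andP; split; [exact: lt | exact: ge].
  by rewrite eqxx (set_nth_default K H) ?sc // cl.
Qed.

Lemma qlength_clen N H l : submod B (cap N H) -> clen B (cap N H) H l -> qlength Sg N H l.
Proof.
move=> sN cl; split.
  have [c [sc _ cP cS]] := clen_chain sN cl.
  exists c; split=> //; split=> // j /cP [s1 s2 s3]; split=> //; split=> //.
move=> c [cP cS].
(* Each strict inclusion of the chain raises the length over [cap N H] by at least one, so the
   [j]-th term has length at least [j]. *)
have bound j : (j < size c)%N -> exists2 l', clen B (cap N H) (nth H c j) l' & (j <= l')%N.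
  elim: j => [|j IH] lt; have [sK [NK KH]] := cP _ lt.
    by have [l' [cK _ _]] := clen_sub sN cl sK NK KH; exists l'.
  have [l1 cl1 le1] := IH (ltnW lt).
  have [sK1 [NK1 KH1]] := cP _ (ltnW lt).
  have [l' [cK _ _]] := clen_sub sN cl sK NK KH; exists l' => //.
  have [inc [x [x1 x2]]] := cS _ lt.
  have [l2 [cl2 _ lt2]] := clen_sub sN cK sK1 NK1 inc.
  rewrite (clen_uniq sN cl1 cl2) in le1; apply: (leq_ltn_trans le1).
  by apply: lt2 => /(_ _ x1).
case E: (size c) => [//|m].
have [|l' cl' le] := bound m; first by rewrite E.
have [|sK [NK KH]] := cP m; first by rewrite E.
have [l2 [cl2 le2 _]] := clen_sub sN cl sK NK KH.
by rewrite ltnS (leq_trans le) // (clen_uniq sN cl' cl2).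
Qed.

Lemma qlength_uniq N H l l' : qlength Sg N H l -> qlength Sg N H l' -> l = l'.
Proof.
move=> [[c [qc sc]] max] [[c' [qc' sc']] max'].
by apply/eqP; rewrite eqn_leq -ltnS -sc max' // -ltnS -sc' max.
Qed.

End QLength.

(** * Finite length of an artinian local ring *)

Section Scalars.
Variables (S : comNzRingType) (B : S -> Prop).
Hypotheses (B1 : B 1) (BB : forall x y, B x -> B y -> B (x - y)).
Hypothesis BM : forall x y, B x -> B y -> B (x * y).

Lemma scal0 : B 0. Proof. by rewrite -(subrr 1); exact: BB. Qed.
Lemma scalN x : B x -> B (- x). Proof. by rewrite -sub0r; exact: BB scal0. Qed.
Lemma scalX x n : B x -> B (x ^+ n).
Proof. by move=> Bx; elim: n => [//|n IH]; rewrite exprS; exact: BM. Qed.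

Lemma submod_scal : submod B (B : S^o -> Prop).
Proof.
split; last by move=> a v; exact: BM.
split; first exact: scal0.
split; last exact: scalN.
by move=> x y Bx /scalN By; rewrite -[y]opprK; exact: BB.
Qed.

(* Hopkins' theorem: a local ring with the descending chain condition has finite length. *)
Section Artinian.
Definition scal_ideal (I : S -> Prop) := incl I B /\ submod B (I : S^o -> Prop).
Variable mm : S -> Prop.
Hypothesis dcc : forall f : nat -> S -> Prop, (forall i, scal_ideal (f i)) ->
  (forall i, incl (f i.+1) (f i)) -> exists N, forall i, (N <= i)%N -> incl (f i) (f i.+1).
Hypotheses (mmI : scal_ideal mm) (mm1 : ~ mm 1).
Hypothesis mm_max : forall I, scal_ideal I -> ~ I 1 -> incl I mm.

Lemma scal_multiples (a : S) : B a -> scal_ideal (multiples B (a : S^o)).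
Proof.
move=> Ba; split; first by move=> _ [b Bb ->]; exact: BM.
exact: submod_multiples.
Qed.

Lemma unit_of_not_max a : B a -> ~ mm a -> exists2 b, B b & b * a = 1.
Proof.
move=> Ba nma; apply: NNPP => nb; apply: nma.
apply: (mm_max (scal_multiples Ba)); last exact: (multiples_id B1 (a : S^o)).
by case=> b Bb bE; apply: nb; exists b.
Qed.

(** The ideals generated by the powers of [a] stabilize, so [a^n = b a^(n+1)], that is
    [(1 - b a) a^n = 0]; and [1 - b a] is a unit because it lies outside [mm]. *)
Lemma max_nilpotent a : mm a -> exists n, a ^+ n = 0.
Proof.
move=> ma; have Ba := mmI.1 _ ma.
have [||n /(_ n (leqnn n))] := dcc (f := fun n => multiples B (a ^+ n : S^o)).
- by move=> i; apply: scal_multiples; exact: scalX.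
- move=> i _ [b Bb ->]; exists (b * a); first exact: BM.
  by rewrite /GRing.scale /= -mulrA -exprS.
move/(_ _ (multiples_id B1 (a ^+ n : S^o))) => [b Bb E].
have [||c Bc cE] := @unit_of_not_max (1 - b * a).
- by apply: BB => //; exact: BM.
- move=> m1; apply: mm1; rewrite -(subrK (b * a) 1).
  by apply: (submodD mmI.2 m1); exact: (submodZ mmI.2 Bb ma).
exists n; rewrite -[LHS]mul1r -cE -mulrA mulrBl mul1r {1}E /GRing.scale /=.
by rewrite -mulrA -exprS subrr mulr0.
Qed.

Lemma scal_ideal_wf :
  well_founded (fun I J => [/\ scal_ideal I, scal_ideal J & sincl I J]).
Proof.
apply: wf_of_no_infinite_descent => f fP.
have [||n /(_ n (leqnn n)) le] := dcc (f := f).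
- by move=> i; have [] := fP i.
- by move=> i; have [_ _ []] := fP i.
by have [_ _ [_ [x [/le]]]] := fP n.
Qed.

(* If [I] is killed by the maximal ideal and has infinite length, then it contains an infinite
   independent sequence [v], and the spans of the tails of [v] violate [dcc]. *)
Lemma finite_length_of_killed I : scal_ideal I -> (forall a x, mm a -> I x -> a * x = 0) ->
  exists l, clen B (pzero : S^o -> Prop) I l.
Proof.
move=> [IB sI] kill; apply: NNPP => ninf.
pose span := @lspan S S^o B.
have sspan s : submod B (span s) by exact: submod_lspan.
have spanI s : (forall x, x \in s -> I x) -> incl (span s) I by exact: (lspan_incl sI).
(* As [mm] kills [I], a multiple [a v] outside [K] has [a] outside [mm]; then [a] is a unit and [v]
   is recovered. So adding [v] adds at most one simple factor. *)
have ext v K : I v -> submod B K -> exists l, clen B K (psum (multiples B (v : S^o)) K) l.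
  move=> Iv sK; have sv := submod_multiples B1 BB BM (v : S^o).
  have [Kv|nKv] := classic (K v).
    exists 0%N; suff -> : psum (multiples B (v : S^o)) K = K by exact: clen0.
    apply: predext; last exact: (psum_inclr sv).
    by apply: (psum_least sK) => //; exact: (multiples_incl sK).
  exists 1%N; apply: (clenS (clen0 B K)); first exact: submod_psum.
  split; first split; first exact: (psum_inclr sv).
    by exists v; split=> //; apply: (psum_incll sK); exact: (multiples_id B1).
  move=> L sL KL LH; have [LK|/not_incl [x [Lx nKx]]] := classic (incl L K); first by left.
  right; apply: (psum_least sL) => //; apply: (multiples_incl sL).
  have [_ [y [[a Ba ->] Ky xE]]] := LH _ Lx.
  have Lav : L (a *: (v : S^o)).
    by apply: (submodDr sL (y := y)); rewrite -?xE //; exact: KL.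
  have [|b Bb ba1] := @unit_of_not_max a Ba.
    by move=> /kill /(_ Iv) av; apply: nKx; rewrite xE /GRing.scale /= av add0r.
  have -> : (v : S^o) = b *: (a *: (v : S^o)) by rewrite scalerA ba1 scale1r.
  exact: (submodZ sL).
have spanfin s : (forall x, x \in s -> I x) -> exists l, clen B (pzero : S^o -> Prop) (span s) l.
  elim: s => [|v s IH] sP /=; first by exists 0%N; exact: clen0.
  have [|l cl] := IH; first by move=> x xs; apply: sP; rewrite inE xs orbT.
  have [|l' cl'] := @ext v (span s) _ (sspan s); first by apply: sP; rewrite inE eqxx.
  by exists (l + l')%N; exact: clen_trans cl cl'.
(* The property is conditional on [s] lying in [I], so that the recursion can be written before its
   values are known to lie there. *)
have next (s : seq S) : {x | (forall x, x \in s -> I x) -> I x /\ ~ span s x}.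
  apply: constructive_indefinite_description.
  have [sP|nsP] := classic (forall x, x \in s -> I x); last by exists 0 => /nsP.
  have [|x xP] := @not_incl _ I (span s); last by exists x.
  move=> le; apply: ninf; have [l cl] := spanfin s sP; exists l.
  by rewrite (predext le (spanI s sP)).
pose s := fix s n := if n is n'.+1 then sval (next (s n')) :: s n' else [::].
pose v n := sval (next (s n)).
have sS n : s n.+1 = v n :: s n by [].
have sI' n x : x \in s n -> I x.
  elim: n x => [//|n IH] x; rewrite sS inE => /orP[/eqP ->|/IH //].
  by have [] := svalP (next (s n)) IH.
have vI n : I (v n) by have [] := svalP (next (s n)) (@sI' n).
have nv n : ~ span (s n) (v n) by have [] := svalP (next (s n)) (@sI' n).
have vs n i : (i < n)%N -> span (s n) (v i).
  move=> lt; apply: lspan_mem => //; elim: n lt => [//|n IH].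
  by rewrite ltnS leq_eqVlt sS inE => /orP[/eqP ->|/IH ->]; rewrite ?eqxx ?orbT.
(* [t n k] consists of [v n], ..., [v (n+k-1)], so that [W n] below is the span of the whole tail
   starting at [n]. *)
pose t n := fix t k := if k is k'.+1 then v (n + k')%N :: t k' else [::].
have tS n k : t n k.+1 = v (n + k)%N :: t n k by [].
have tI n k x : x \in t n k -> I x.
  by elim: k => [//|k IH]; rewrite tS inE => /orP[/eqP ->|/IH].
pose W n : S^o -> Prop := fun x => exists k, span (t n k) x.
have tmono n k k' x : (k <= k')%N -> span (t n k) x -> span (t n k') x.
  move/subnK <-; elim: (k' - k)%N => [//|j IH] tx; rewrite addSn tS /=.
  exact: (psum_inclr (submod_multiples B1 BB BM _) (IH tx)).
have sW n : submod B (W n).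
  split; first split; first by exists 0%N.
    split=> [x y [k kx] [k' ky]|x [k kx]]; last by exists k; exact: (submodN (sspan _)).
    exists (maxn k k'); apply: (submodD (sspan _)).
      by apply: tmono kx; exact: leq_maxl.
    by apply: tmono ky; exact: leq_maxr.
  by move=> a x Ba [k kx]; exists k; exact: (submodZ (sspan _)).
have WB n : incl (W n) B by move=> x [k kx]; apply: IB; exact: (spanI _ (@tI n k)).
have Wdec n : incl (W n.+1) (W n).
  move=> x [k kx]; exists k.+1; elim: k x kx => [|k IH] x.
    by move=> ->; exact: (submod0 (sspan _)).
  rewrite !tS addSnnS => -[y [z [y1 z1 ->]]]; exists y, z; split=> //; exact: IH.
have ts n k : incl (span (t n k)) (span (s (n + k)%N)).
  elim: k => [|k IH] x; first by move=> ->; exact: (submod0 (sspan _)).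
  rewrite tS addnS sS => -[y [z [y1 z1 ->]]]; exists y, z; split=> //; exact: IH.
(* In an expression of [v n] through later vectors, the last coefficient either lies in [mm], and
   its term vanishes, or is a unit, and the last vector depends on earlier ones. *)
have nW n : ~ W n.+1 (v n).
  case=> k; elim: k => [v0|k IH].
    by apply: (nv n); rewrite v0; exact: (submod0 (sspan _)).
  rewrite tS => -[_ [y [[a Ba ->] ty vE]]].
  have [ma|nma] := classic (mm a).
    by apply: IH; rewrite vE [_ *: _](kill _ _ ma (vI _)) add0r.
  have [b Bb ba1] := unit_of_not_max Ba nma.
  apply: (nv (n.+1 + k)%N).
  have -> : v (n.+1 + k)%N = b *: ((v n : S^o) - y).
    by rewrite vE addrK scalerA ba1 scale1r.
  apply: (submodZ (sspan _) Bb); apply: (submodB (sspan _)); last exact: ts.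
  by apply: vs; rewrite addSn ltnS leq_addr.
have [n /(_ n (leqnn n)) le] := dcc (fun n => conj (@WB n) (sW n)) Wdec.
apply: (nW n); apply: le; exists 1%N; rewrite tS addn0 /=.
exact: (psum_incll (sspan [::]) (multiples_id B1 (v n : S^o))).
Qed.

(** Let [I] be minimal of infinite length. If [aI] and the kernel of [a] on [I] were both proper,
    they would have finite length, and so would [I]; hence [a] maps [I] onto itself or kills it.
    Elements of [mm] are nilpotent, so in both cases they kill [I], and [finite_length_of_killed]
    gives a contradiction. *)
Lemma artinian_ideal_finite_length I : scal_ideal I ->
  exists l, clen B (pzero : S^o -> Prop) I l.
Proof.
elim/(well_founded_ind scal_ideal_wf): I => I IH [IB sI]; apply: NNPP => ninf.
have sub J : submod B (J : S^o -> Prop) -> incl J I -> ~ incl I J ->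
    exists l, clen B (pzero : S^o -> Prop) J l.
  move=> sJ JI nIJ; apply: IH; last by split=> //; exact: incl_trans JI IB.
  split=> //; first by split=> //; exact: incl_trans JI IB.
  by split=> //; exact: not_incl.
pose f a : S^o -> S^o := fun x => a * x.
have fD a x y : f a (x + y) = f a x + f a y by exact: mulrDr.
have fZ a (c : S) x : f a (c *: x) = c *: f a x by exact: mulrCA.
have s0 := @submod_pzero S S^o B.
have dich a : B a -> incl I (fimage (f a) I) \/ forall x, I x -> a * x = 0.
  move=> Ba; have [|nI] := classic (incl I (fimage (f a) I)); [by left|right].
  have [|l cl] := sub _ (submod_image (fD a) (fZ a) sI) _ nI.
    by move=> _ [x Ix ->]; exact: (submodZ (x := (x : S^o)) sI Ba Ix).
  pose J := fpreimage (f a) I pzero.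
  have sJ : submod B J by exact: submod_preimage.
  have [IJ|nIJ] := classic (incl I J); first by move=> x /IJ [].
  have JI : incl J I by move=> x [].
  have [l1 cl1] := sub J sJ JI nIJ.
  case: ninf; exists (l1 + l)%N; apply: (clen_trans cl1).
  apply: (@clen_preimage _ B _ _ (f a) (fD a) (fZ a) J I pzero) => //.
    by move=> x Ix; split=> [|[]].
  have -> // : psum (fimage (f a) I) pzero = fimage (f a) I.
  apply: predext; last exact: (psum_incll s0).
  by move=> _ [x [_ [Jx -> ->]]]; rewrite addr0.
apply: ninf; apply: finite_length_of_killed => // a x ma Ix.
have [Ia|] := dich a (mmI.1 _ ma); last exact.
have [n an] := max_nilpotent ma.
suff In m y : I y -> exists2 z, I z & y = a ^+ m * z.
  by have [z _ ->] := In n x Ix; rewrite an mul0r mulr0.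
elim: m y => [|m IHm] y Iy; first by exists y; rewrite ?mul1r.
have [z /Ia [w Iw ->] ->] := IHm y Iy.
by exists w => //; rewrite exprSr -mulrA.
Qed.

End Artinian.
End Scalars.

(** * Noetherian modules *)

Section Noetherian.
Variables (S : comNzRingType).

Definition noeth (V : lmodType S) (G : S -> Prop) (H : V -> Prop) :=
  forall c : nat -> V -> Prop, (forall i, submod G (c i)) -> (forall i, incl (c i) H) ->
  (forall i, incl (c i) (c i.+1)) -> exists n, forall i, (n <= i)%N -> incl (c i) (c n).

Lemma chain_mono (T : Type) (c : nat -> T -> Prop) i j :
  (forall i, incl (c i) (c i.+1)) -> (i <= j)%N -> incl (c i) (c j).
Proof.
move=> asc /subnK <-; elim: (j - i)%N => [//|k IH]; rewrite addSn.
exact: incl_trans (asc _).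
Qed.

Section OneModule.
Variable V : lmodType S.
Implicit Types (G : S -> Prop) (H K : V -> Prop).

Lemma noeth_wf G H : noeth G H -> well_founded (fun K' K =>
  [/\ submod G K' /\ incl K' H, submod G K /\ incl K H & sincl K K']).
Proof.
move=> nH; apply: wf_of_no_infinite_descent => f fP.
have [||i|n /(_ n.+1 (leqnSn n)) le] := nH f.
- by move=> i; have [_ []] := fP i.
- by move=> i; have [_ []] := fP i.
- by have [_ _ []] := fP i.
- by have [_ _ [_ [x [/le]]]] := fP n.
Qed.

(** The lengths of the terms stay below [l] and grow at each strict inclusion; the induction is on
    the remaining room [l - li]. *)
Lemma noeth_of_clen G H l : clen G pzero H l -> noeth G H.
Proof.
move=> cl c sc cH asc; have s0 := @submod_pzero S V G.
have len i : exists li, clen G pzero (c i) li /\ (li <= l)%N.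
  by have [li [cli le _]] := clen_sub s0 cl (sc i) (pzero_incl (sc i)) (cH i); exists li.
suff aux n i li : clen G pzero (c i) li -> (l - li <= n)%N ->
    exists n, forall i, (n <= i)%N -> incl (c i) (c n).
  by have [li [cli _]] := len 0%N; exact: (aux l 0%N li cli (leq_subr _ _)).
elim: n i li => [|n IH] i li cli le;
  have [st|nst] := classic (forall j, (i <= j)%N -> incl (c j) (c i)); try by exists i.
all: have [j nj] := not_all_ex_not _ _ nst; have [ij nij] := imply_to_and _ _ nj.
all: have [lj [clj lejl]] := len j.
all: have [l' [cl' _ /(_ nij)]] := clen_sub s0 clj (sc i) (pzero_incl (sc i)) (chain_mono asc ij).
all: rewrite (clen_uniq s0 cl' cli) => lt.
  by move: le; rewrite leqn0 subn_eq0 => /(leq_trans lejl)/(leq_trans lt); rewrite ltnn.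
apply: (IH j lj clj); rewrite -ltnS; apply: leq_trans le.
by apply: ltn_sub2l => //; exact: leq_trans lejl.
Qed.

Section Adjoin.
Variables (G : S -> Prop) (V0 : V -> Prop) (x : S).
Hypotheses (sV0 : submod G V0) (nV0 : noeth G V0).

(* Hilbert's basis theorem for modules: [adjoin] is the module V0[x] of polynomials in [x] with
   coefficients in [V0], and [lead K n] collects the leading coefficients in degree [n] of the
   elements of [K]. Expansions in powers of [x] need not be unique. *)
Fixpoint powspan n : V -> Prop := if n is n'.+1
  then fun v => exists u w, [/\ V0 u, powspan n' w & v = x ^+ n' *: u + w] else pzero.
Definition adjoin v := exists n, powspan n v.
Definition lead K n : V -> Prop := fun u => V0 u /\ exists2 w, powspan n w & K (x ^+ n *: u + w).

Lemma submod_powspan n : submod G (powspan n).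
Proof.
elim: n => [|n IH] /=; first exact: submod_pzero.
split; first split.
- by exists 0, 0; split; [exact: (submod0 sV0)|exact: (submod0 IH)|rewrite scaler0 addr0].
- split=> [_ _ [u [w [u1 w1 ->]]] [u' [w' [u1' w1' ->]]]|_ [u [w [u1 w1 ->]]]].
    exists (u + u'), (w + w'); split; [exact: (submodD sV0)|exact: (submodD IH)|].
    by rewrite scalerDr addrACA.
  exists (- u), (- w); split; [exact: (submodN sV0)|exact: (submodN IH)|].
  by rewrite scalerN opprD.
- move=> a _ Ga [u [w [u1 w1 ->]]].
  exists (a *: u), (a *: w); split; [exact: (submodZ sV0)|exact: (submodZ IH)|].
  by rewrite scalerDr !scalerA mulrC.
Qed.

Lemma powspanS n : incl (powspan n) (powspan n.+1).
Proof.
by move=> v nv; exists 0, v; split; rewrite ?scaler0 ?add0r //; exact: (submod0 sV0).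
Qed.

Lemma powspanM n v : powspan n v -> powspan n.+1 (x *: v).
Proof.
elim: n v => [|n IH] v; first by move=> ->; rewrite scaler0; exact: (submod0 (submod_powspan 1)).
move=> [u [w [u1 w1 ->]]]; exists u, (x *: w); split=> //; first exact: IH.
by rewrite scalerDr scalerA -exprS.
Qed.

(** For additive subgroups, closure under a set of scalars is the same as closure under the subring
    it generates, so one element is added and no ring is built. *)
Definition scal_adjoin : S -> Prop := fun a => G a \/ a = x.

Lemma submod_adjoin : submod scal_adjoin adjoin.
Proof.
have up m n v : (m <= n)%N -> powspan m v -> powspan n v.
  by move=> le; exact: (chain_mono powspanS le).
split; first split; first by exists 0%N.
- split=> [v w [m mv] [n nw]|v [n nv]]; last by exists n; exact: (submodN (submod_powspan n)).
  exists (maxn m n); apply: (submodD (submod_powspan _)).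
    exact: up (leq_maxl _ _) mv.
  exact: up (leq_maxr _ _) nw.
- move=> a v [Ga|->] [n nv]; first by exists n; exact: (submodZ (submod_powspan n)).
  by exists n.+1; exact: powspanM.
Qed.

Lemma adjoin_incl : incl V0 adjoin.
Proof. by move=> v v1; exists 1%N, v, 0; split; rewrite // expr0 scale1r addr0. Qed.

Lemma submod_lead K n : submod scal_adjoin K -> submod G (lead K n).
Proof.
move=> sK; have sP := submod_powspan n; split; first split.
- split; first exact: (submod0 sV0).
  by exists 0; [exact: (submod0 sP)|rewrite scaler0 addr0; exact: (submod0 sK)].
- split=> [u v [u1 [w w1 Ku]] [v1 [z z1 Kv]]|u [u1 [w w1 Ku]]].
    split; first exact: (submodD sV0).
    by exists (w + z); [exact: (submodD sP)|rewrite scalerDr addrACA; exact: (submodD sK)].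
  split; first exact: (submodN sV0).
  by exists (- w); [exact: (submodN sP)|rewrite scalerN -opprD; exact: (submodN sK)].
- move=> a u Ga [u1 [w w1 Ku]]; split; first exact: (submodZ sV0).
  exists (a *: w); first exact: (submodZ sP).
  rewrite scalerA mulrC -scalerA -scalerDr; apply: (submodZ sK) => //; by left.
Qed.

Lemma leadS K n : submod scal_adjoin K -> incl (lead K n) (lead K n.+1).
Proof.
move=> sK u [u1 [w w1 Ku]]; split=> //; exists (x *: w); first exact: powspanM.
by rewrite exprS -scalerA -scalerDr; apply: (submodZ sK) => //; right.
Qed.

Lemma lead_mono K K' n : incl K K' -> incl (lead K n) (lead K' n).
Proof. by move=> KK' u [u1 [w w1 Ku]]; split=> //; exists w => //; exact: KK'. Qed.

(** An element of [K'] is corrected by one of [K] with the same leading coefficient, which lowers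
    its degree in [x]. *)
Lemma lead_incl K K' : submod scal_adjoin K -> submod scal_adjoin K' -> incl K K' ->
  incl K' adjoin -> (forall n, incl (lead K' n) (lead K n)) -> incl K' K.
Proof.
move=> sK sK' KK' K'a le v K'v; have [n] := K'a _ K'v.
elim: n v K'v => [|n IH] v K'v; first by move=> ->; exact: (submod0 sK).
move=> [u [w [u1 w1 vE]]].
have [|_ [z z1 Kz]] := le n u; first by split=> //; exists w => //; rewrite -vE.
have vE' : v = (x ^+ n *: u + z) + (w - z) by rewrite vE addrACA subrr addr0.
rewrite vE'; apply: (submodD sK) => //; apply: IH.
  have -> : w - z = v - (x ^+ n *: u + z) by rewrite vE' [RHS]addrC addKr.
  by apply: (submodB sK') => //; exact: KK'.
exact: (submodB (submod_powspan n)).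
Qed.

(** The modules [lead (c i) n] increase in [i] and in [n]. The diagonal stabilizes at some [N],
    which settles all degrees from [N] on; the finitely many lower degrees stabilize separately,
    from a common [j0] on. Past both indices [lead_incl] applies. *)
Lemma noeth_adjoin : noeth scal_adjoin adjoin.
Proof.
move=> c sc ca asc.
have lV0 i n : incl (lead (c i) n) V0 by move=> u [].
have lmono i j n : (i <= j)%N -> incl (lead (c i) n) (lead (c j) n).
  by move=> le; apply: lead_mono; exact: chain_mono.
have lmono2 i m n : (m <= n)%N -> incl (lead (c i) m) (lead (c i) n).
  by move=> le; apply: (chain_mono (c := lead (c i))) => // k; exact: leadS.
have [|i|i|N NP] := nV0 (c := fun i => lead (c i) i).
- by move=> i; exact: submod_lead.
- exact: lV0.
- exact: incl_trans (leadS (sc _)) (lead_mono (asc _)).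
have [j0 j0P] : exists j0, forall n i, (n < N)%N -> (j0 <= i)%N ->
    incl (lead (c i) n) (lead (c j0) n).
  elim: N {NP} => [|m [j0 j0P]]; first by exists 0%N.
  have [|i|i|k kP] := nV0 (c := fun i => lead (c i) m).
  - by move=> i; exact: submod_lead.
  - exact: lV0.
  - exact: lead_mono.
  exists (maxn j0 k) => n i; rewrite ltnS leq_eqVlt geq_max => /orP[/eqP ->|lt] /andP[le1 le2].
    by apply: incl_trans (kP i le2) _; apply: lmono; exact: leq_maxr.
  by apply: incl_trans (j0P n i lt le1) _; apply: lmono; exact: leq_maxl.
exists (maxn j0 N) => i; rewrite geq_max => /andP[ij0 iN].
apply: lead_incl => // [|n]; first by apply: chain_mono => //; rewrite geq_max ij0.
have [lt|ge] := ltnP n N.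
  by apply: incl_trans (j0P n i lt ij0) _; apply: lmono; exact: leq_maxl.
pose m := maxn i n.
apply: incl_trans (lmono i m n (leq_maxl _ _)) _.
apply: incl_trans (lmono2 m n m (leq_maxr _ _)) _.
apply: incl_trans (NP m (leq_trans iN (leq_maxl _ _))) _.
exact: incl_trans (lmono N _ N (leq_maxr _ _)) (lmono2 _ N n ge).
Qed.

End Adjoin.

Lemma noeth_adjoin_seq (gs : seq S) G V0 : submod G V0 -> noeth G V0 -> exists W : V -> Prop,
  [/\ incl V0 W, submod (fun a => G a \/ a \in gs) W & noeth (fun a => G a \/ a \in gs) W].
Proof.
elim: gs G V0 => [|x gs IH] G V0 sV0 nV0.
  exists V0; have -> : (fun a => G a \/ a \in [::]) = G by apply: predext => a; [case|left].
  by split=> //; exact: incl_refl.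
have [W [VW sW nW]] := IH _ _ (submod_adjoin x sV0) (noeth_adjoin sV0 nV0).
exists W; have -> : (fun a => G a \/ a \in x :: gs) = (fun a => scal_adjoin G x a \/ a \in gs).
  apply: predext => a; rewrite inE.
    by case=> [Ga|/orP[/eqP ->|ags]]; [left; left|left; right|right].
  by case=> [[Ga|->]|->]; [left|right; rewrite eqxx|right; rewrite orbT].
by split=> //; by move=> v V0v; apply: VW; exact: adjoin_incl.
Qed.

End OneModule.

Variable B : S -> Prop.
Hypotheses (B1 : B 1) (BB : forall x y, B x -> B y -> B (x - y)).
Hypothesis BM : forall x y, B x -> B y -> B (x * y).
Variable lB : nat.
Hypothesis finB : clen B (pzero : S^o -> Prop) B lB.

Section Finite.
Variable V : lmodType S.
Implicit Types (K H : V -> Prop).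

(** The factor is the quotient of [B] by the scalars that send [v] into [K], and [B] has finite
    length. *)
Lemma clen_cyclic K v : submod B K -> exists l, clen B K (psum (multiples B v) K) l.
Proof.
move=> sK; pose f (a : S^o) : V := a *: v.
have fD x y : f (x + y) = f x + f y by exact: scalerDl.
have fZ a x : f (a *: x) = a *: f x by rewrite /f scalerA.
have sB := submod_scal B1 BB BM.
have sA := submod_preimage fD fZ sB sK.
have [|x []//|l cl] := clen_quot (@submod_pzero S S^o B) finB sA; first exact: (pzero_incl sA).
exists l; apply: (clen_image fD fZ sA sB sK _ _ cl); last by move=> x [].
by move=> a Ba; split=> [|[]].
Qed.

Lemma clen_lspan (s : seq V) : exists l, clen B pzero (lspan B s) l.
Proof.
elim: s => [|v s [l cl]] /=; first by exists 0%N; exact: clen0.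
have [l' cl'] := clen_cyclic v (submod_lspan B1 BB BM s).
by exists (l + l')%N; exact: clen_trans cl cl'.
Qed.

(** The [B]-span of the module generators has finite length, hence is Noetherian, and adjoining the
    ring generators keeps it so. The scalars preserving the resulting [W] form a subring containing
    all generators, so [W] is everything. *)
Lemma noeth_fg (gs : seq S) (ms : seq V) :
  generates B (fun s => s \in gs) ->
  (forall v, exists cs : seq S, size cs = size ms /\ v = \sum_(j < size ms) cs`_j *: ms`_j) ->
  noeth (fun _ => True) (fun _ : V => True).
Proof.
move=> gen fg; have [l cl] := clen_lspan ms.
have sL := submod_lspan B1 BB BM ms.
have [W [LW sW nW]] := noeth_adjoin_seq gs sL (noeth_of_clen cl).
have WS s v : W v -> W (s *: v).
  apply: (gen (fun s => forall v, W v -> W (s *: v))); split; first by move=> w; rewrite scale1r.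
  split; first by move=> x y xP yP w Ww; rewrite scalerBl; apply: (submodB sW); auto.
  split; first by move=> x y xP yP w Ww; rewrite -scalerA; auto.
  by split=> [x Bx|x xg] w Ww; apply: (submodZ sW) => //; [left|right].
have Wall v : W v.
  have [cs [_ ->]] := fg v; apply: (submod_sum sW) => j _ _; apply: WS; apply: LW.
  exact: (lspan_mem B1 BB BM (mem_nth 0 (ltn_ord j))).
move=> c sc _ asc; apply: nW => // i; last by move=> v _; exact: Wall.
by have [a b] := sc i; split=> // x v _; exact: b.
Qed.

End Finite.
End Noetherian.

(** * Graded modules *)

Section Degrees.
Variable d : nat.
Implicit Types m n p q : deg d.

Definition dsub m n : deg d := [ffun i => (m i - n i)%N].
Definition dmax m n : deg d := [ffun i => maxn (m i) (n i)].

Lemma daddA m n p : dadd m (dadd n p) = dadd (dadd m n) p.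
Proof. by apply/ffunP => i; rewrite !ffunE addnA. Qed.
Lemma daddC m n : dadd m n = dadd n m.
Proof. by apply/ffunP => i; rewrite !ffunE addnC. Qed.
Lemma dadd0 m : dadd m (dzero d) = m.
Proof. by apply/ffunP => i; rewrite !ffunE addn0. Qed.
Lemma dadd0d m : dadd (dzero d) m = m.
Proof. by rewrite daddC dadd0. Qed.
Lemma dle_refl n : dle n n. Proof. by []. Qed.
Lemma dle_trans m n p : dle m n -> dle n p -> dle m p.
Proof. by move=> mn np i; exact: leq_trans (mn i) (np i). Qed.
Lemma dle_addl m n : dle n (dadd m n). Proof. by move=> i; rewrite ffunE leq_addl. Qed.
Lemma dle_addr m n : dle m (dadd m n). Proof. by move=> i; rewrite ffunE leq_addr. Qed.
Lemma dle_maxl m n : dle m (dmax m n). Proof. by move=> i; rewrite ffunE leq_maxl. Qed.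
Lemma dle_maxr m n : dle n (dmax m n). Proof. by move=> i; rewrite ffunE leq_maxr. Qed.
Lemma dsubK m n : dle m n -> dadd m (dsub n m) = n.
Proof. by move=> le; apply/ffunP => i; rewrite !ffunE subnKC. Qed.
Lemma daddKr m n : dsub (dadd m n) m = n.
Proof. by apply/ffunP => i; rewrite !ffunE addKn. Qed.
Lemma daddI m : injective (dadd m).
Proof. by move=> n p E; rewrite -(daddKr m n) E daddKr. Qed.
Lemma dsub_le m n p : dle (dadd m p) n -> dle p (dsub n m).
Proof.
move=> le i; have := le i; rewrite !ffunE => le'.
by rewrite leq_subRL ?(leq_trans (leq_addr _ _) le').
Qed.


Lemma degree_pred n k : (\sum_i n i)%N = k.+1 ->
  exists p i, n = dadd p (dunit i) /\ (\sum_i p i)%N = k.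
Proof.
move=> E; have [i ni] : exists i, (0 < n i)%N.
  apply: NNPP => nex; suff: (\sum_i n i = 0)%N by rewrite E.
  apply: big1 => i _; apply/eqP; rewrite -leqn0 leqNgt; apply/negP => ni.
  by apply: nex; exists i.
have nE : dadd (dsub n (dunit i)) (dunit i) = n.
  by rewrite daddC; apply: dsubK => j; rewrite ffunE; case: eqP => // ->.
exists (dsub n (dunit i)), i; split=> //; apply: (@addnI 1).
rewrite [RHS]add1n -E -[in RHS]nE; under [RHS]eq_bigr do rewrite ffunE.
rewrite big_split /= [RHS]addnC; congr addn; rewrite (bigD1 i) //= ffunE eqxx big1 // => j ji.
by rewrite ffunE (negbTE ji).
Qed.

Definition eventually (Q : deg d -> Prop) := exists w, forall n, dle w n -> Q n.

Lemma eventually_and (Q R : deg d -> Prop) :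
  eventually Q -> eventually R -> eventually (fun n => Q n /\ R n).
Proof.
move=> [v vQ] [w wR]; exists (dmax v w) => n le.
split; first by apply: vQ; exact: dle_trans (dle_maxl v w) le.
by apply: wR; exact: dle_trans (dle_maxr v w) le.
Qed.

Lemma eventually_mono (Q R : deg d -> Prop) : incl Q R -> eventually Q -> eventually R.
Proof. by move=> QR [v vQ]; exists v => n /vQ/QR. Qed.

Lemma eventually_shift p (Q : deg d -> Prop) : eventually Q -> eventually (fun n => Q (dadd n p)).
Proof. by move=> [v vQ]; exists v => n le; apply: vQ; exact: dle_trans le (dle_addr _ _). Qed.

Lemma eventually_unshift p (Q : deg d -> Prop) : eventually (fun n => Q (dadd n p)) -> eventually Q.
Proof.
move=> [v vQ]; exists (dadd p v) => n le.
have pn := dle_trans (dle_addr p v) le.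
by rewrite -(dsubK pn) daddC; apply: vQ; exact: dsub_le.
Qed.

Lemma eventually_const (Q : Prop) : eventually (fun _ => Q) -> Q.
Proof. by move=> [w]; apply; exact: dle_refl. Qed.

(* Compatible with addition, so that top components multiply to the top component of a product:
   this reduces primality of a homogeneous ideal to homogeneous elements. *)
Definition dlex m n := ([multinom m i | i < d] <= [multinom n i | i < d])%O.

Lemma dlex_trans m n p : dlex m n -> dlex n p -> dlex m p.
Proof. exact: le_trans. Qed.
Lemma dlex_total m n : dlex m n || dlex n m.
Proof. exact: le_total. Qed.
Lemma dlex_anti m n : dlex m n -> dlex n m -> m = n.
Proof.
move=> mn nm; have /mnmP E : [multinom m i | i < d] = [multinom n i | i < d].
  by apply/eqP; rewrite eq_le; apply/andP; split.
by apply/ffunP => i; have := E i; rewrite !mnmE.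
Qed.
Lemma dlex_add m n p q : dlex m n -> dlex p q -> dadd m p = dadd n q -> m = n.
Proof.
move=> mn pq E; apply: (dlex_anti mn); rewrite /dlex -(lemc_add2l _ _ [multinom q i | i < d]).
have -> : ([multinom n i | i < d] + [multinom q i | i < d])%MM =
    ([multinom m i | i < d] + [multinom p i | i < d])%MM.
  by apply/mnmP => i; rewrite !mnmE; have := congr1 (fun h : deg d => h i) E; rewrite !ffunE => ->.
by rewrite lemc_add2r.
Qed.

Lemma dlex_max (D : seq (deg d)) (Q : deg d -> Prop) :
  (exists2 n, n \in D & Q n) ->
  exists m, [/\ m \in D, Q m & forall n, n \in D -> Q n -> dlex n m].
Proof.
elim: D => [[]//|n D IH] [m]; rewrite inE => mD Qm.
have [[p pD Qp]|nex] := classic (exists2 p, p \in D & Q p); last first.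
  have mn : m = n by case/orP: mD => [/eqP//|mD]; case: nex; exists m.
  exists m; rewrite mn inE eqxx; split=> //; first by rewrite -mn.
  move=> q; rewrite inE => /orP[/eqP -> _|qD Qq]; first exact: lexx.
  by case: nex; exists q.
have [|m' [m'D Qm' max]] := IH; first by exists p.
have [[Qn lt]|nQ] := classic (Q n /\ dlex m' n).
  exists n; rewrite inE eqxx; split=> // q; rewrite inE => /orP[/eqP -> _|qD Qq]; first exact: lexx.
  exact: dlex_trans (max _ qD Qq) lt.
exists m'; rewrite inE m'D orbT; split=> // q; rewrite inE => /orP[/eqP -> Qn|]; last exact: max.
by case/orP: (dlex_total n m') => // h; case: nQ.
Qed.

End Degrees.

(** * Homogeneous components *)

Section Components.
Variables (d : nat) (V : zmodType) (F : deg d -> V -> Prop).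
Hypothesis hF : dirsum F.

Lemma hom0 n : F n 0. Proof. by have [] := hF.1 n. Qed.
Lemma homD n x y : F n x -> F n y -> F n (x + y).
Proof. by have [_ [h _]] := hF.1 n; exact: h. Qed.
Lemma homN n x : F n x -> F n (- x).
Proof. by have [_ [_ h]] := hF.1 n; exact: h. Qed.
Lemma hom_sum n (I : eqType) (r : seq I) (P : pred I) (f : I -> V) :
  (forall i, i \in r -> P i -> F n (f i)) -> F n (\sum_(i <- r | P i) f i).
Proof.
move=> h; rewrite big_seq_cond; apply: (big_ind (F n)); first exact: hom0.
- by move=> x y; exact: homD.
- by move=> i /andP[]; exact: h.
Qed.

Lemma sum_by_degree (ls : seq (deg d * V)) (D : seq (deg d)) : uniq D ->
  (forall p, p \in ls -> p.1 \in D) ->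
  \sum_(p <- ls) p.2 = \sum_(n <- D) \sum_(p <- ls | p.1 == n) p.2.
Proof.
move=> uD sub; rewrite (exchange_big_dep xpredT) //= big_seq [RHS]big_seq.
apply: eq_bigr => p /sub pD; rewrite (eq_bigl (fun n => n == p.1)).
  by rewrite -big_filter filter_pred1_uniq // big_seq1.
by move=> n; rewrite eq_sym.
Qed.

(** Directness is assumed only for lists with distinct degrees; grouping the entries by degree
    reduces any list to that case. *)
Lemma sum_zero_by_degree (ls : seq (deg d * V)) n : (forall p, p \in ls -> F p.1 p.2) ->
  \sum_(p <- ls) p.2 = 0 -> \sum_(p <- ls | p.1 == n) p.2 = 0.
Proof.
move=> lsF; set D := undup (map fst ls).
have pD p : p \in ls -> p.1 \in D by move=> pls; rewrite mem_undup; exact: map_f.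
rewrite (sum_by_degree (undup_uniq _) pD) => E.
pose g n := (n, \sum_(p <- ls | p.1 == n) p.2).
have [nD|nD] := boolP (n \in D); last first.
  by rewrite big_seq_cond big1 // => p /andP[/pD pn /eqP E']; rewrite -E' pn in nD.
apply: (hF.2.2 (map g D) _ _ _ (g n)).
- by rewrite -map_comp map_id_in ?undup_uniq.
- move=> _ /mapP[m _ ->] /=; apply: hom_sum => p pls /eqP <-; exact: lsF.
- by rewrite big_map.
- exact: map_f.
Qed.

(** The decomposition is an arbitrary choice and may repeat degrees; [comp] collects the entries of
    one degree, and [comp_sum_list] shows independence of the choice. *)
Definition decomp v : seq (deg d * V) :=
  sval (constructive_indefinite_description _ (hF.2.1 v)).
Definition comp n v := \sum_(p <- decomp v | p.1 == n) p.2.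
Definition dsupp v : seq (deg d) := undup (map fst (decomp v)).

Lemma decomp_hom v p : p \in decomp v -> F p.1 p.2.
Proof. by rewrite /decomp; case: constructive_indefinite_description => ls [] /= h _; exact: h. Qed.
Lemma decomp_sum v : \sum_(p <- decomp v) p.2 = v.
Proof. by rewrite /decomp; case: constructive_indefinite_description => ls []. Qed.

Lemma comp_hom n v : F n (comp n v).
Proof. by apply: hom_sum => p /decomp_hom pF /eqP <-. Qed.

Lemma comp_sum_list (ls : seq (deg d * V)) n : (forall p, p \in ls -> F p.1 p.2) ->
  comp n (\sum_(p <- ls) p.2) = \sum_(p <- ls | p.1 == n) p.2.
Proof.
move=> lsF; set v := \sum_(p <- ls) p.2.
pose ls' := ls ++ map (fun p => (p.1, - p.2)) (decomp v).
have := @sum_zero_by_degree ls' n; rewrite !big_cat !big_map /= !sumrN decomp_sum subrr.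
move=> h; apply/esym/eqP; rewrite -subr_eq0; apply/eqP/h => // p; rewrite mem_cat.
by case/orP => [/lsF//|/mapP[q /decomp_hom qF ->]]; exact: homN.
Qed.

Lemma compD n v w : comp n (v + w) = comp n v + comp n w.
Proof.
rewrite -{1}(decomp_sum v) -{1}(decomp_sum w) -big_cat comp_sum_list ?big_cat // => p.
by rewrite mem_cat => /orP[]; exact: decomp_hom.
Qed.

Lemma comp0 n : comp n 0 = 0.
Proof. by apply: (addrI (comp n 0)); rewrite -compD !addr0. Qed.

Lemma compN n v : comp n (- v) = - comp n v.
Proof. by apply: (addrI (comp n v)); rewrite -compD !subrr comp0. Qed.

Lemma comp_sum n (I : Type) (r : seq I) (P : pred I) (f : I -> V) :
  comp n (\sum_(i <- r | P i) f i) = \sum_(i <- r | P i) comp n (f i).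
Proof. by apply: (big_morph (comp n)); [exact: compD | exact: comp0]. Qed.

Lemma comp_of_hom m n v : F m v -> comp n v = if m == n then v else 0.
Proof.
move=> mv; have := @comp_sum_list [:: (m, v)] n; rewrite big_seq1 big_mkcond big_seq1 /=.
by apply => p; rewrite inE => /eqP ->.
Qed.

Lemma comp_id n v : F n v -> comp n v = v.
Proof. by move/comp_of_hom ->; rewrite eqxx. Qed.

Lemma comp_notin n v : n \notin dsupp v -> comp n v = 0.
Proof.
rewrite mem_undup => nv; rewrite /comp big_seq_cond big1 // => p /andP[pv /eqP E].
by rewrite -E map_f in nv.
Qed.

Lemma comp_expand v : v = \sum_(n <- dsupp v) comp n v.
Proof.
rewrite -[LHS]decomp_sum; apply: sum_by_degree (undup_uniq _) _ => p pv.
by rewrite mem_undup map_f.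
Qed.

Lemma uniq_dsupp v : uniq (dsupp v). Proof. exact: undup_uniq. Qed.

End Components.

Section GradedModules.
Variables (d : nat) (S : comNzRingType) (M : lmodType S).
Variables (Sg : deg d -> S -> Prop) (Mg : deg d -> M -> Prop).
Hypotheses (hS : graded_ring Sg) (hMd : dirsum Mg).
Hypothesis hMs : forall m n a v, Sg m a -> Mg n v -> Mg (dadd m n) (a *: v).
Local Notation sc := (comp hS.1).
Local Notation mc := (comp hMd).
Local Notation B := (Sg (dzero d)).

Lemma scalB1 : B 1. Proof. by case: hS => _ []. Qed.
Lemma scalBB x y : B x -> B y -> B (x - y).
Proof. by move=> Bx By; apply: (homD hS.1) => //; exact: (homN hS.1). Qed.
Lemma scalBM x y : B x -> B y -> B (x * y).
Proof. by move=> Bx By; rewrite -[dzero d]dadd0; case: hS => _ [_]; apply. Qed.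

Lemma hom_mul m n a b : Sg m a -> Sg n b -> Sg (dadd m n) (a * b).
Proof. by case: hS => _ [_]; apply. Qed.

Lemma submod_hom n : submod B (Mg n).
Proof. by split=> [|a v Ba Mv]; [exact: hMd.1|rewrite -(dadd0d n); exact: hMs]. Qed.

Lemma mc_scal n s v : mc n (s *: v) =
  \sum_(p <- dsupp hS.1 s) \sum_(q <- dsupp hMd v | dadd p q == n) sc p s *: mc q v.
Proof.
rewrite {1}(comp_expand hS.1 s) {1}(comp_expand hMd v) scaler_suml comp_sum.
apply: eq_bigr => p _; rewrite scaler_sumr comp_sum [RHS]big_mkcond.
apply: eq_bigr => q _; rewrite (@comp_of_hom _ _ _ _ (dadd p q)) //.
by apply: hMs; exact: comp_hom.
Qed.

Lemma mc_scal_homl m n a v : Sg m a -> mc (dadd m n) (a *: v) = a *: mc n v.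
Proof.
move=> ma; rewrite {1}(comp_expand hMd v) scaler_sumr comp_sum.
rewrite [in RHS](comp_expand hMd v) comp_sum scaler_sumr; apply: eq_bigr => q _.
have Mq := comp_hom hMd q v.
rewrite (comp_of_hom _ _ (hMs ma Mq)) (comp_of_hom _ _ Mq) (inj_eq (@daddI d m)).
by case: eqP; rewrite ?scaler0.
Qed.

Lemma mc_scal_homr m n s v : Mg m v -> mc (dadd n m) (s *: v) = sc n s *: v.
Proof.
move=> mv; rewrite {1}(comp_expand hS.1 s) scaler_suml comp_sum.
rewrite [in RHS](comp_expand hS.1 s) comp_sum scaler_suml; apply: eq_bigr => q _.
have Sq := comp_hom hS.1 q s.
rewrite (comp_of_hom _ _ (hMs Sq mv)) (comp_of_hom _ _ Sq) ![dadd _ m]daddC (inj_eq (@daddI d m)).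
by case: eqP; rewrite ?scale0r.
Qed.

Lemma mc_scal_homr0 m n s v : Mg m v -> ~ dle m n -> mc n (s *: v) = 0.
Proof.
move=> mv nle; rewrite {1}(comp_expand hS.1 s) scaler_suml comp_sum big1 // => q _.
rewrite (comp_of_hom _ _ (hMs (comp_hom hS.1 q s) mv)); case: eqP => // E.
by case: nle; rewrite -E; exact: dle_addl.
Qed.

End GradedModules.

(** * Support and homogeneous primes *)

Section Support.
Variables (d : nat) (S : comNzRingType) (M : lmodType S).
Variables (Sg : deg d -> S -> Prop) (Mg : deg d -> M -> Prop).
Hypotheses (hS : graded_ring Sg) (hMd : dirsum Mg).
Hypothesis hMs : forall m n a v, Sg m a -> Mg n v -> Mg (dadd m n) (a *: v).
Local Notation sc := (comp hS.1).
Local Notation mc := (comp hMd).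
Local Notation B := (Sg (dzero d)).
Local Notation all_scal := (fun _ : S => True).
Implicit Types (K L N H : M -> Prop) (P : S -> Prop) (m n e : deg d).

Lemma mc_scal_homl0 m n a v : Sg m a -> ~ dle m n -> mc n (a *: v) = 0.
Proof.
move=> ma nle; rewrite {1}(comp_expand hMd v) scaler_sumr comp_sum big1 // => q _.
rewrite (comp_of_hom _ _ (hMs ma (comp_hom hMd q v))); case: eqP => // E.
by case: nle; rewrite -E; exact: dle_addr.
Qed.

Definition gsub K := submod all_scal K /\ forall n v, K v -> K (mc n v).
Definition times (x : S) K : M -> Prop := fimage (fun v => x *: v) K.
Definition part n K : M -> Prop := cap K (Mg n).

Lemma timesD x (v w : M) : x *: (v + w) = x *: v + x *: w. Proof. exact: scalerDr. Qed.
Lemma timesZ x (a : S) (v : M) : x *: (a *: v) = a *: (x *: v).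
Proof. by rewrite !scalerA mulrC. Qed.

Lemma gsub_submod G K : gsub K -> submod G K.
Proof. by move=> [[aK sK] _]; split=> // a v _; exact: sK. Qed.

Lemma gsub_full : gsub (fun _ => True). Proof. by []. Qed.

Lemma gsub_zero : gsub pzero.
Proof. by split=> [|n v ->]; [exact: submod_pzero|rewrite /pzero comp0]. Qed.

Lemma gsub_psum K L : gsub K -> gsub L -> gsub (psum K L).
Proof.
move=> [sK gK] [sL gL]; split=> [|n _ [x [y [Kx Ly ->]]]]; first exact: submod_psum.
by exists (mc n x), (mc n y); split; [exact: gK|exact: gL|rewrite compD].
Qed.

Lemma gsub_multiples m v (P : S -> Prop) : ideal P -> (forall n s, P s -> P (sc n s)) ->
  Mg m v -> gsub (multiples P v).
Proof.
move=> [[P0 [PD PN]] PM] Pc mv; split.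
  split; first split; first by exists 0; rewrite ?scale0r.
  - split=> [_ _ [a Pa ->] [b Pb ->]|_ [a Pa ->]].
      by exists (a + b); rewrite ?scalerDl //; exact: PD.
    by exists (- a); rewrite ?scaleNr //; exact: PN.
  - by move=> a _ _ [b Pb ->]; exists (a * b); rewrite ?scalerA //; exact: PM.
move=> n _ [a Pa ->].
have [le|nle] := classic (dle m n); last first.
  by exists 0; rewrite // scale0r (mc_scal_homr0 hS hMd hMs a mv).
exists (sc (dsub n m) a); first exact: Pc.
by rewrite -(mc_scal_homr hS hMd hMs _ _ mv) daddC dsubK.
Qed.

Lemma gsub_times e x K : Sg e x -> gsub K -> gsub (times x K).
Proof.
move=> ex [sK gK]; split; first exact: (submod_image (timesD x) (timesZ x) sK).
move=> n _ [v Kv ->]; have [le|nle] := classic (dle e n); last first.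
  by exists 0; [exact: (submod0 sK)|rewrite scaler0 (mc_scal_homl0 _ ex nle)].
exists (mc (dsub n e) v); first exact: gK.
by rewrite -(mc_scal_homl hMd hMs _ _ ex) dsubK.
Qed.

Lemma submod_part n K : gsub K -> submod B (part n K).
Proof. by move=> gK; apply: submod_cap; [exact: gsub_submod|exact: submod_hom]. Qed.

Lemma gsub_ext K v : gsub K -> (forall n, K (mc n v)) -> K v.
Proof. by move=> [sK _] h; rewrite (comp_expand hMd v); apply: (submod_sum sK) => n _ _. Qed.

Lemma gsub_not_incl N H : gsub N -> gsub H -> ~ incl H N -> exists m v, [/\ Mg m v, H v & ~ N v].
Proof.
move=> gN gH /not_incl [v [Hv nNv]]; apply: NNPP => nex; apply: nNv.
apply: (gsub_ext gN) => m; apply: NNPP => nN; apply: nex.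
by exists m, (mc m v); split=> //; [exact: comp_hom|exact: gH.2].
Qed.

Lemma homog_prime_comp P n s : homog_prime Sg P -> P s -> P (sc n s).
Proof.
move=> [[[P0 _] _] [_ [_ h]]] Ps.
have [nD|nD] := boolP (n \in dsupp hS.1 s); last by rewrite comp_notin.
pose g n := (n, sc n s); apply: (h s Ps (map g (dsupp hS.1 s)) _ _ _ (g n)).
- by rewrite -map_comp map_id uniq_dsupp.
- by move=> _ /mapP[m _ ->]; exact: comp_hom.
- by rewrite big_map -comp_expand.
- exact: map_f.
Qed.

(** For [a], [b] outside [P], let [m], [n] be the largest degrees whose components lie outside [P].
    In degree [m + n] of [ab], every term but the product of these two components has a factor in
    [P], so that product lies in [P] too. *)
Lemma homog_primeI P : ideal P -> ~ P 1 -> (forall n s, P s -> P (sc n s)) ->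
  (forall m n a b, Sg m a -> Sg n b -> P (a * b) -> P a \/ P b) -> homog_prime Sg P.
Proof.
move=> iP P1 Pc Ph; have [[P0 [PD PN]] PM] := iP.
have PMr a x : P x -> P (x * a) by rewrite mulrC; exact: PM.
have Psum (I : eqType) (r : seq I) (Q : pred I) (f : I -> S) :
    (forall i, i \in r -> Q i -> P (f i)) -> P (\sum_(i <- r | Q i) f i).
  move=> h; rewrite big_seq_cond; apply: (big_ind P) => // i /andP[]; exact: h.
split=> //; split=> //; split; last first.
  move=> s Ps ls uls lsS sE p pls.
  suff -> : p.2 = sc p.1 s by exact: Pc.
  rewrite sE comp_sum_list // -big_filter.
  have -> : [seq q <- ls | q.1 == p.1] = [:: p]; last by rewrite big_seq1.
  elim: ls uls pls {lsS sE} => //= q ls IH /andP[nq uls]; rewrite inE => /orP[/eqP ->|pls].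
    rewrite eqxx; congr (_ :: _); apply/eqP; rewrite -[_ == _]negbK -has_filter.
    by apply/hasPn => r rls; apply: contra nq => /eqP <-; exact: map_f.
  by rewrite (IH uls pls) ifN //; apply: contra nq => /eqP ->; exact: map_f.
move=> a b Pab; apply: NNPP => /not_or_and [nPa nPb].
have top c : ~ P c -> exists m, ~ P (sc m c) /\ forall n, ~ P (sc n c) -> dlex n m.
  move=> nPc; have [|m [_ nPm max]] := @dlex_max _ (dsupp hS.1 c) (fun n => ~ P (sc n c)).
    apply: NNPP => nex; apply: nPc; rewrite (comp_expand hS.1 c); apply: Psum => n nD _.
    by apply: NNPP => nP; apply: nex; exists n.
  exists m; split=> // n nPn; apply: max => //.
  by have [//|nD] := boolP (n \in dsupp hS.1 c); rewrite comp_notin in nPn.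
have [m [nPm maxm]] := top a nPa; have [n [nPn maxn]] := top b nPb.
suff Pmn : P (sc m a * sc n b).
  by have [] := Ph m n _ _ (comp_hom hS.1 m a) (comp_hom hS.1 n b) Pmn.
have hSs : forall m n (x : S) (v : S^o), Sg m x -> Sg n v -> Sg (dadd m n) (x *: v).
  by move=> *; exact: hom_mul.
have inD c q : ~ P (sc q c) -> q \in dsupp hS.1 c.
  by move=> nP; apply/negPn/negP => qn; rewrite comp_notin in nP.
have := Pc (dadd m n) _ Pab.
have -> : sc (dadd m n) (a * b) = _ :=
  mc_scal (M := S^o) hS hS.1 hSs (dadd m n) a (b : S^o).
rewrite (bigD1_seq m) ?uniq_dsupp ?inD //= => Psumab.
have -> : sc m a * sc n b =
    \sum_(q <- dsupp hS.1 b | dadd m q == dadd m n) sc m a *: (sc q b : S^o).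
  rewrite (eq_bigl (fun q => q == n)); last by move=> q; rewrite (inj_eq (@daddI d m)).
  by rewrite -big_filter filter_pred1_uniq ?uniq_dsupp ?inD // big_seq1.
rewrite -[X in P X](addrK (\sum_(p <- dsupp hS.1 a | p != m)
  \sum_(q <- dsupp hS.1 b | dadd p q == dadd m n) sc p a *: (sc q b : S^o))).
apply: PD => //; apply: PN; apply: (Psum) => p _ pm; apply: (Psum) => q _ /eqP E.
have [Pp|nPp] := classic (P (sc p a)); first exact: PMr.
have [Pq|nPq] := classic (P (sc q b)); first exact: PM.
by case/eqP: pm; exact: dlex_add (maxm _ nPp) (maxn _ nPq) E.
Qed.

Definition ann N v : S -> Prop := fun s => N (s *: v).

Lemma submod_ann N v : gsub N -> submod all_scal (ann N v : S^o -> Prop).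
Proof.
move=> [sN _]; split; first split; first by rewrite /ann scale0r; exact: (submod0 sN).
- split=> [x y Nx Ny|x Nx]; rewrite /ann; first by rewrite scalerDl; exact: (submodD sN).
  by rewrite scaleNr; exact: (submodN sN).
- by move=> a x _ Nx; rewrite /ann -scalerA; exact: (submodZ sN).
Qed.

Lemma ann_comp N m v n s : gsub N -> Mg m v -> ann N v s -> ann N v (sc n s).
Proof.
move=> [_ gN] mv /(gN (dadd n m)); by rewrite (mc_scal_homr hS hMd hMs _ _ mv).
Qed.

Lemma ideal_ann N v : gsub N -> ideal (ann N v).
Proof. by move=> gN; have [aA mA] := submod_ann v gN; split=> // a x; exact: mA. Qed.

Hypothesis nS : noeth all_scal (fun _ : S^o => True).

(* An annihilator that is maximal among those of homogeneous elements of [H / N] is prime. *)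
Lemma exists_prime_ann N H : gsub N -> gsub H -> ~ incl H N ->
  exists m v, [/\ Mg m v, H v, ~ N v & homog_prime Sg (ann N v)].
Proof.
move=> gN gH /(gsub_not_incl gN gH) [m [v [mv Hv nNv]]].
move: {2}(ann N v) (erefl (ann N v)) => I; move: m v mv Hv nNv.
elim/(well_founded_ind (noeth_wf nS)): I => I IH m v mv Hv nNv IE.
have [[m' [v' [mv' Hv' nNv' inc]]]|max] := classic (exists m' v',
    [/\ Mg m' v', H v', ~ N v' & sincl (ann N v) (ann N v')]).
  apply: (IH (ann N v') _ m' v') => //; rewrite -IE.
  by split=> //; split=> //; exact: submod_ann.
exists m, v; split=> //; apply: homog_primeI.
- exact: ideal_ann.
- by rewrite /ann scale1r.
- by move=> n s; exact: (ann_comp _ gN mv).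
- move=> p q a b pa qb Nab; apply: NNPP => /not_or_and [nNa nNb].
  (* If [b v] is nonzero modulo [N], its annihilator contains that of [v] and also [a], against
     maximality. *)
  apply: max; exists (dadd q m), (b *: v); split.
  + exact: hMs.
  + exact: (submodZ gH.1).
  + exact: nNb.
  + split; last by exists a; split=> //; rewrite /ann scalerA.
    by move=> s Ns; rewrite /ann scalerA mulrC -scalerA; exact: (submodZ gN.1).
Qed.

(** The support of the factor [H/N]: the condition on [v] says that [ann N v] lies in [P], that is,
    [v] survives in the localization at [P]. *)
Definition supp_quot N H P := homog_prime Sg P /\
  ~ (forall n : deg d, (forall i, (1 <= n i)%N) -> incl (Sg n) P) /\
  exists2 v : M, H v & forall s, ~ P s -> ~ N (s *: v).

Lemma supp_quot_pp N : supp_quot N (fun _ => True) = supp_pp Sg N.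
Proof.
apply: predext => P [hP [nP h]]; split=> //; split=> //.
  by have [v _ vP] := h; exists v.
by have [v vP] := h; exists v.
Qed.

Lemma supp_quot_mono N N' H H' : incl N N' -> incl H H' -> incl (supp_quot N' H) (supp_quot N H').
Proof.
move=> NN' HH' P [hP [nP [v Hv h]]]; split=> //; split=> //.
by exists v; [exact: HH'|move=> s Ps /NN'; exact: h].
Qed.

(** If each component of [v] were sent into [N] by some element outside [P], the product of these
    finitely many elements would be outside [P] and send [v] into [N]. *)
Lemma supp_quot_hom N H P : gsub N -> gsub H -> supp_quot N H P ->
  exists m v, [/\ Mg m v, H v & incl (ann N v) P].
Proof.
move=> gN gH [hP [_ [v Hv h]]]; apply: NNPP => nex.
have [_ [P1 [Ppr _]]] := hP.
have [t nPt tN] : exists2 t, ~ P t & forall m, m \in dsupp hMd v -> N (t *: mc m v).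
  elim: (dsupp hMd v) => [|m D [t nPt tN]]; first by exists 1.
  have [|t' [Nt' nPt']] := @not_incl _ (ann N (mc m v)) P.
    move=> inc; apply: nex; exists m, (mc m v); split=> //; first exact: comp_hom.
    exact: gH.2.
  exists (t * t'); first by move=> /Ppr [].
  move=> n; rewrite inE => /orP[/eqP ->|/tN Nt].
    by rewrite -scalerA; exact: (submodZ gN.1).
  by rewrite mulrC -scalerA; exact: (submodZ gN.1).
apply: (h t nPt); rewrite (comp_expand hMd v) scaler_sumr.
by apply: (submod_sum gN.1) => m /tN.
Qed.

Hypothesis Sstd : generates B (fun s => exists i, Sg (dunit i) s).

(** The elements whose components of degree [n] with [n i >= 1] all lie in [P] form a subring
    containing [A] and every [S_j], hence all of [S]. *)
Lemma degree_one_sub_prime P i : homog_prime Sg P -> incl (Sg (dunit i)) P ->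
  forall n, (1 <= n i)%N -> incl (Sg n) P.
Proof.
move=> hP iP; have [[[P0 [PD PN]] PM] _] := hP.
suff all s n : (1 <= n i)%N -> P (sc n s).
  by move=> n ni s ns; rewrite -(comp_id hS.1 ns); exact: all.
move: n; apply: (Sstd (R := fun s => forall n, (1 <= n i)%N -> P (sc n s))).
have hSs : forall m n (x : S) (v : S^o), Sg m x -> Sg n v -> Sg (dadd m n) (x *: v).
  by move=> *; exact: hom_mul.
split; [|split; [|split; [|split]]].
- move=> n ni; rewrite (comp_of_hom _ _ (scalB1 hS)); case: eqP => // E.
  by rewrite -E ffunE in ni.
- by move=> x y xP yP n ni; rewrite compD compN; apply: PD; [exact: xP|apply: PN; exact: yP].
- move=> x y xP yP n ni.
  have -> : sc n (x * y) = _ := mc_scal (M := S^o) hS hS.1 hSs n x (y : S^o).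
  apply: (big_ind P) => // p _; apply: (big_ind P) => // q /eqP E.
  have : (0 < p i + q i)%N by rewrite -E ffunE in ni.
  rewrite addn_gt0 => /orP[/xP xp|/yP yq]; last exact: PM.
  by rewrite /GRing.scale /= mulrC; exact: PM.
- move=> x Bx n ni; rewrite (comp_of_hom _ _ Bx); case: eqP => // E.
  by rewrite -E ffunE in ni.
- move=> x [j jx] n ni; rewrite (comp_of_hom _ _ jx); case: eqP => // E.
  move: ni jx; rewrite -E ffunE; case: eqP => // <- _; exact: iP.
Qed.

Lemma degree_one_notin_prime P i : homog_prime Sg P ->
  ~ (forall n : deg d, (forall i, (1 <= n i)%N) -> incl (Sg n) P) ->
  exists x, Sg (dunit i) x /\ ~ P x.
Proof.
move=> hP nP; apply: not_incl => iP; apply: nP => n n1.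
exact: degree_one_sub_prime iP _ (n1 i).
Qed.

Lemma hom_notin_prime P n : homog_prime Sg P ->
  ~ (forall n : deg d, (forall i, (1 <= n i)%N) -> incl (Sg n) P) ->
  exists x, Sg n x /\ ~ P x.
Proof.
move=> hP nP; have [_ [P1 [Ppr _]]] := hP.
move E: (\sum_i n i)%N => k; elim: k n E => [|k IH] n E.
  have -> : n = dzero d.
    apply/ffunP => i; rewrite ffunE; apply/eqP; rewrite -leqn0 -E.
    by rewrite (bigD1 i) //= leq_addr.
  by exists 1; split=> //; exact: scalB1.
have [p [i [nE pE]]] := degree_pred E.
have [x [px nPx]] := IH p pE.
have [y [iy nPy]] := degree_one_notin_prime i hP nP.
exists (x * y); rewrite nE; split; first exact: hom_mul.
by move=> /Ppr [].
Qed.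

(** * Hilbert functions of graded factors *)

Hypothesis nM : noeth all_scal (fun _ : M => True).
Variable lB : nat.
Hypothesis finB : clen B (pzero : S^o -> Prop) B lB.

(** A chain of [A]-submodules of [M_n] lifts to the [S]-submodules [L i] of those [v] for which
    every [(s v)_n] lies in [c i]. Nothing is lost: on [M_n] the component [(s v)_n] is [s_0 v], so
    [L i] meets [M_n] in [c i]. *)
Lemma noeth_part n : noeth B (Mg n).
Proof.
move=> c cs cM asc.
pose L i : M -> Prop := fun v => forall s, c i (mc n (s *: v)).
have [||i v Lv s|N NP] := nM (c := L) => //.
- move=> i; split; first split; first by move=> s; rewrite scaler0 comp0; exact: (submod0 (cs i)).
  + split=> [v w Lv Lw s|v Lv s]; first by rewrite scalerDr compD; exact: (submodD (cs i)).
    by rewrite scalerN compN; exact: (submodN (cs i)).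
  + by move=> a v _ Lv s; rewrite scalerA; exact: Lv.
- exact: asc.
exists N => i iN v iv; have Mv := cM _ _ iv.
have Lv : L i v.
  move=> s; rewrite -[n in mc n _](dadd0d n) (mc_scal_homr hS hMd hMs _ _ Mv).
  by apply: (submodZ (cs i)) => //; exact: comp_hom.
by have := NP i iN v Lv 1; rewrite scale1r comp_id.
Qed.

Lemma finite_length_hom n K : submod B K -> incl K (Mg n) -> exists l, clen B K (Mg n) l.
Proof.
move: K; apply: (well_founded_ind (noeth_wf (@noeth_part n))) => K IH sK KM.
have [MK|/not_incl [v [Mv nKv]]] := classic (incl (Mg n) K).
  by exists 0%N; rewrite (predext KM MK); exact: clen0.
have [[B1 BB] BM] := (scalB1 hS, scalBB hS, scalBM hS).
have [l cl] := clen_cyclic B1 BB BM finB v sK.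
have sv := submod_multiples B1 BB BM v.
have sM := submod_hom hMd hMs n.
have K'M : incl (psum (multiples B v) K) (Mg n).
  by apply: (psum_least sM) => //; exact: (multiples_incl sM).
have KK' : incl K (psum (multiples B v) K) := psum_inclr sv.
have [|l' cl'] := IH (psum (multiples B v) K) _ (submod_psum sv sK) K'M.
  split; [by split=> //; exact: submod_psum|by []|split=> //].
  by exists v; split=> //; exact: (psum_incll sK (multiples_id B1 v)).
by exists (l + l')%N; exact: clen_trans cl cl'.
Qed.

(** A total function, given its meaning by [lenP], so that differences can be taken without carrying
    existence proofs along. *)
Definition len N H n : nat :=
  epsilon (inhabits 0%N) (fun l => clen B (part n N) (part n H) l).

Lemma part_mono n N H : incl N H -> incl (part n N) (part n H).
Proof. by move=> NH v [/NH]. Qed.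

Lemma lenP N H n : gsub N -> gsub H -> incl N H -> clen B (part n N) (part n H) (len N H n).
Proof.
move=> gN gH NH; apply: epsilon_spec.
have sN := submod_part n gN; have sH := submod_part n gH.
have [|l cl] := finite_length_hom (n := n) sN; first by move=> v [].
have [|l' [cl' _ _]] := clen_sub sN cl sH (part_mono NH); first by move=> v [].
by exists l'.
Qed.

Lemma len_eq N H n l : gsub N -> gsub H -> incl N H ->
  clen B (part n N) (part n H) l -> len N H n = l.
Proof. by move=> gN gH NH; exact: clen_uniq (submod_part n gN) (lenP n gN gH NH). Qed.

Lemma len_add N K H n : gsub N -> gsub K -> gsub H -> incl N K -> incl K H ->
  len N H n = (len N K n + len K H n)%N.
Proof.
move=> gN gK gH NK KH; apply: len_eq => //; first exact: incl_trans KH.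
exact: clen_trans (lenP n gN gK NK) (lenP n gK gH KH).
Qed.

Lemma len0 N H n : gsub N -> gsub H -> incl N H -> (len N H n = 0%N <-> incl (part n H) N).
Proof.
move=> gN gH NH; split=> [l0|HN].
  by have := lenP n gN gH NH; rewrite l0 => /clen0_eq <- v [].
apply: (len_eq gN gH NH).
have -> : part n H = part n N; last exact: clen0.
by apply: predext; [move=> v Hv; split; [exact: HN|case: Hv]|exact: part_mono].
Qed.

Lemma part_times e n x N H : Sg e x -> gsub H -> gsub N ->
  part (dadd e n) (psum (times x H) N) = psum (times x (part n H)) (part (dadd e n) N).
Proof.
move=> ex gH gN; apply: predext => v.
  move=> [[_ [y [[h Hh ->] Ny vE]]] Mv].
  exists (x *: mc n h), (mc (dadd e n) y); split.
  - by exists (mc n h) => //; split; [exact: gH.2|exact: comp_hom].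
  - by split; [exact: gN.2|exact: comp_hom].
  - by rewrite -(comp_id hMd Mv) vE compD (mc_scal_homl hMd hMs _ _ ex).
move=> [_ [y [[h [Hh Mh] ->] [Ny My] ->]]]; split.
  by exists (x *: h), y; split=> //; exists h.
by apply: (homD hMd) => //; exact: hMs.
Qed.

(** Multiplication by [x] identifies [(H/N)_n] with the degree [e + n] part of [(xH + N')/N'].
    Injectivity is asked in the single degree [n], since filter-regularity grants it only in large
    degrees. *)
Lemma len_times e x N N' H n : Sg e x -> gsub N -> gsub N' -> gsub H -> incl N H ->
  (forall v, part n H v -> N' (x *: v) <-> N v) ->
  len N' (psum (times x H) N') (dadd e n) = len N H n.
Proof.
move=> ex gN gN' gH NH inj.
have gx := gsub_psum (gsub_times ex gH) gN'.
apply: len_eq => //; first exact: (psum_inclr (gsub_submod all_scal (gsub_times ex gH))).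
rewrite part_times //; apply: (clen_image (timesD x) (timesZ x)) (lenP n gN gH NH).
- exact: submod_part.
- exact: submod_part.
- exact: submod_part.
- move=> v Hv; have [h1 h2] := inj v Hv; split=> [[/h1 Nv _]|[/h2 Nv Mv]]; split=> //.
    by case: Hv.
  exact: hMs.
- exact: part_mono.
Qed.

End Support.

(** * Eventually polynomial functions *)

Section Differences.
Variable d : nat.
Implicit Types (f g : deg d -> rat) (l : seq 'I_d) (n : deg d).

Definition Delta i f : deg d -> rat := fun n => f (dadd n (dunit i)) - f n.
Definition Deltas l f := foldr Delta f l.

(* All [s]-fold differences of [f] vanish eventually, so [f] is eventually a polynomial of degree
   less than [s]. *)
Fixpoint poly_below s f : Prop :=
  if s is s'.+1 then forall i, poly_below s' (Delta i f) else eventually (fun n => f n = 0).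

Lemma Delta_eventually i f g : eventually (fun n => f n = g n) ->
  eventually (fun n => Delta i f n = Delta i g n).
Proof.
move=> ev; have := eventually_and ev (eventually_shift (dunit i) ev).
by apply: eventually_mono => n [E1 E2]; rewrite /Delta E1 E2.
Qed.

Lemma Deltas_eventually l f g : eventually (fun n => f n = g n) ->
  eventually (fun n => Deltas l f n = Deltas l g n).
Proof. by move=> ev; elim: l => //= i l; exact: Delta_eventually. Qed.

Lemma poly_below_ext s f g : eventually (fun n => f n = g n) -> poly_below s f -> poly_below s g.
Proof.
elim: s f g => [|s IH] f g ev /=.
  by move/(eventually_and ev); apply: eventually_mono => n [<-].
by move=> fP i; apply: IH (fP i); exact: Delta_eventually.
Qed.

Lemma Delta_cst i (c : rat) : Delta i (fun _ => c) = fun _ => 0.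
Proof. by apply: functional_extensionality => n; rewrite /Delta subrr. Qed.

Lemma poly_below_zero s f : eventually (fun n => f n = 0) -> poly_below s f.
Proof.
elim: s f => [//|s IH] f ev i; apply: IH.
by have := Delta_eventually i (g := fun _ => 0) ev; rewrite Delta_cst.
Qed.

Lemma poly_belowD s f g : poly_below s f -> poly_below s g -> poly_below s (fun n => f n + g n).
Proof.
elim: s f g => [|s IH] f g /= fP gP.
  by apply: eventually_mono (eventually_and fP gP) => n [-> ->]; rewrite addr0.
move=> i; apply: poly_below_ext (IH _ _ (fP i) (gP i)).
by exists (dzero d) => n _; rewrite /Delta opprD addrACA.
Qed.

Lemma poly_below_shift s p f : poly_below s f -> poly_below s (fun n => f (dadd n p)).
Proof.
elim: s f => [|s IH] f /= fP; first exact: eventually_shift fP.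
move=> i; apply: poly_below_ext (IH _ (fP i)).
by exists (dzero d) => n _; rewrite /Delta -!daddA [dadd p _]daddC.
Qed.

Lemma poly_belowE s f :
  poly_below s f <-> forall l, size l = s -> eventually (fun n => Deltas l f n = 0).
Proof.
elim: s f => [|s IH] f /=; first by split=> [ev l /size0nil -> //|/(_ [::] erefl)].
split=> [fP l|fP i]; last first.
  by apply/IH => l sl; have := fP (rcons l i); rewrite size_rcons sl /Deltas foldr_rcons; exact.
case/lastP: l => // l i; rewrite size_rcons => -[sl].
by have /IH/(_ l sl) := fP i; rewrite /Deltas foldr_rcons.
Qed.

Lemma Deltas_cat l l' f : Deltas (l ++ l') f = Deltas l (Deltas l' f).
Proof. by rewrite /Deltas foldr_cat. Qed.

Lemma poly_below_Deltas s f l : poly_below s f -> (s <= size l)%N ->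
  eventually (fun n => Deltas l f n = 0).
Proof.
move=> fP le; rewrite -(cat_take_drop (size l - s) l) Deltas_cat.
have sd : size (drop (size l - s) l) = s by rewrite size_drop subKn.
have ev := (poly_belowE s f).1 fP _ sd.
have := Deltas_eventually (take (size l - s) l) (g := fun _ => 0) ev.
apply: eventually_mono => n ->.
by elim: (take _ _) n => //= i l' IH n; rewrite /Delta !IH subrr.
Qed.

Lemma DeltaC i j f : Delta i (Delta j f) = Delta j (Delta i f).
Proof.
apply: functional_extensionality => n; rewrite /Delta -!daddA [dadd (dunit i) _]daddC.
by rewrite !opprD !opprK addrACA.
Qed.

Lemma Deltas_perm l l' f : perm_eq l l' -> Deltas l f = Deltas l' f.
Proof.
have mid i (a b : seq 'I_d) : Deltas (a ++ i :: b) f = Delta i (Deltas (a ++ b) f).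
  by elim: a => //= j a ->; rewrite DeltaC.
elim: l l' => [|i l IH] l' pll'; first by move: pll'; rewrite perm_sym => /perm_nilP ->.
have il' : i \in l' by rewrite -(perm_mem pll') inE eqxx.
case/splitPr: il' pll' => a b; rewrite mid perm_sym perm_catC /= perm_cons perm_sym => p.
by rewrite /= (IH (a ++ b)) // (perm_trans p) // perm_catC.
Qed.

Lemma DeltaB i f g : Delta i (fun n => f n - g n) = fun n => Delta i f n - Delta i g n.
Proof. by apply: functional_extensionality => n; rewrite /Delta !opprD opprK addrACA. Qed.

Lemma DeltasB l f g : Deltas l (fun n => f n - g n) = fun n => Deltas l f n - Deltas l g n.
Proof. by elim: l => //= i l ->; rewrite DeltaB. Qed.

Lemma DeltasZ l (c : rat) f : Deltas l (fun n => c * f n) = fun n => c * Deltas l f n.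
Proof.
elim: l => //= i l ->; apply: functional_extensionality => n.
by rewrite /Delta mulrBr.
Qed.

Lemma Deltas_sum l (I : Type) (r : seq I) (F : I -> deg d -> rat) :
  Deltas l (fun n => \sum_(i <- r) F i n) = fun n => \sum_(i <- r) Deltas l (F i) n.
Proof.
elim: l => //= i l ->; apply: functional_extensionality => n.
by rewrite /Delta -sumrB.
Qed.

Lemma exists_seq_count (m : 'X_{1..d}) : exists l : seq 'I_d, forall j, count_mem j l = m j.
Proof.
exists (flatten [seq nseq (m i) i | i <- index_enum 'I_d]) => j.
rewrite count_flatten sumnE !big_map /= (bigD1 j) //= count_nseq /= eqxx mul1n.
by rewrite big1 ?addn0 // => i /negbTE ij; rewrite count_nseq /= ij.
Qed.

(** * Differences of products, powers and binomial coefficients *)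

Definition diff1 (h : nat -> rat) : nat -> rat := fun t => h t.+1 - h t.

Lemma Deltas_prod l (h : 'I_d -> nat -> rat) :
  Deltas l (fun n => \prod_j h j (n j)) =
  fun n => \prod_j iter (count_mem j l) diff1 (h j) (n j).
Proof.
elim: l => //= i l ->; apply: functional_extensionality => n.
rewrite /Delta (bigD1 i) // [X in _ - X](bigD1 i) // [RHS](bigD1 i) //= !ffunE eqxx addn1.
have E (j : 'I_d) : j != i -> (n j + (j == i) = n j)%N by move/negbTE ->; rewrite addn0.
under eq_bigr => j ji do rewrite ffunE ffunE E //.
under [in RHS]eq_bigr => j ji do rewrite eq_sym (negbTE ji) add0n.
by rewrite -mulrBl.
Qed.

Lemma diff1_sum (I : Type) (r : seq I) (c : I -> rat) (h : I -> nat -> rat) k t :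
  iter k diff1 (fun t => \sum_(i <- r) c i * h i t) t = \sum_(i <- r) c i * iter k diff1 (h i) t.
Proof.
elim: k t => //= k IH t; rewrite /diff1 !IH -sumrB.
by apply: eq_bigr => i _; rewrite mulrBr.
Qed.

(** The first difference of [t^m] is the sum of [C(m,i) t^i] over [i < m]. For [m = k + 1], only the
    term [(k+1) t^k] survives [k] further differences. *)
Lemma diff1_pow k m t : (m <= k)%N ->
  iter k diff1 (fun t => t%:R ^+ m) t = if m == k then (k`!)%:R else 0.
Proof.
elim: k m t => [|k IH] m t; first by rewrite leqn0 => /eqP ->.
move=> le; rewrite iterSr.
have -> : diff1 (fun t => t%:R ^+ m) = fun t => \sum_(i < m) ('C(m, i))%:R * t%:R ^+ i.
  apply: functional_extensionality => u; rewrite /diff1 -[in u.+1]add1n natrD exprDn.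
  rewrite big_ord_recr /= subnn mul1r binn mulr1n addrK.
  by apply: eq_bigr => i _; rewrite expr1n mul1r mulr_natl.
rewrite diff1_sum; case: eqP le => [-> _|/eqP ne le].
  rewrite big_ord_recr /= big1 ?add0r => [|i _]; last by rewrite IH 1?ltnW // ltn_eqF // mulr0.
  by rewrite IH // eqxx binSn -natrM.
have lt : (m <= k)%N by rewrite -ltnS ltn_neqAle ne.
rewrite big1 // => i _; have ik := leq_trans (ltn_ord i) lt.
by rewrite IH 1?ltnW // ltn_eqF // mulr0.
Qed.

Lemma diff1_bin k a t : iter k diff1 (fun t => ('C(t, a))%:R) t =
  if (k <= a)%N then ('C(t, a - k))%:R else 0.
Proof.
elim: k t => [|k IH] t /=; first by rewrite subn0.
rewrite /diff1 !IH; case: (ltngtP k a) => [lt|lt|->]; last by rewrite subnn !bin0 subrr.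
  by rewrite -[(a - k)%N]prednK ?subn_gt0 // binS natrD addrAC subrr add0r subnS.
by rewrite subrr.
Qed.

Lemma size_sum_count (l : seq 'I_d) : size l = (\sum_j count_mem j l)%N.
Proof.
elim: l => [|x l IH] /=; first by rewrite big1.
rewrite IH big_split /= -[LHS]add1n; congr addn.
by rewrite (bigD1 x) //= eqxx big1 // => i; rewrite eq_sym => /negbTE ->.
Qed.

Lemma exists_count_lt (l l' : seq 'I_d) : (size l <= size l')%N -> ~~ perm_eq l' l ->
  exists j, (count_mem j l < count_mem j l')%N.
Proof.
move=> le nperm; apply: NNPP => nex; case/negP: nperm.
have cle j : (count_mem j l' <= count_mem j l)%N.
  by rewrite leqNgt; apply/negP => lt; apply: nex; exists j.
apply/allP => j _ /=; rewrite eqn_leq cle /= leqNgt; apply/negP => lt.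
suff : (size l' < size l)%N by rewrite ltnNge le.
rewrite !size_sum_count (bigD1 j) //= [in X in (_ < X)%N](bigD1 j) //= -addSn.
by apply: leq_add => //; apply: leq_sum.
Qed.

(** These products are dual to iterated differences: among differences of order at least [size l],
    exactly those along permutations of [l] are nonzero on [binoms l], with value one. *)
Definition binoms (l : seq 'I_d) : deg d -> rat := fun n => \prod_j ('C(n j, count_mem j l))%:R.

Lemma Deltas_binoms l l' n : (size l <= size l')%N ->
  Deltas l' (binoms l) n = if perm_eq l' l then 1 else 0.
Proof.
move=> le; rewrite /binoms (Deltas_prod l' (fun j t => ('C(t, count_mem j l))%:R)).
case: ifP => [/permP p|/negbT /(exists_count_lt le) [j lt]].
  by apply: big1 => j _; rewrite diff1_bin p leqnn subnn bin0.
by rewrite (bigD1 j) //= diff1_bin leqNgt lt mul0r.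
Qed.

Definition ev_mpoly (P : {mpoly rat[d]}) : deg d -> rat := fun n => P.@[fun i => (n i)%:R].

Lemma binoms_mpoly l : exists P, ev_mpoly P = binoms l.
Proof.
have one j a : exists P, forall n, ev_mpoly P n = ('C(n j, a))%:R.
  elim: a => [|a [P PE]]; first by exists 1 => n; rewrite /ev_mpoly meval1 bin0.
  (* From [(a+1) C(n,a+1) = (n-a) C(n,a)]; for [n < a] the truncated difference is harmless because
     [C(n,a) = 0]. *)
  exists ((a.+1%:R^-1)%:MP * (P * ('X_j - (a%:R)%:MP))) => n.
  rewrite /ev_mpoly !mevalM mevalB !mevalC mevalXU -/(ev_mpoly P n) PE.
  have a0 : (a.+1%:R : rat) != 0 by rewrite pnatr_eq0.
  apply: (mulfI a0); rewrite mulVKf // -natrM mul_bin_left mulrC.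
  have [le|lt] := leqP a (n j); first by rewrite natrM natrB.
  by rewrite bin_small // mulr0 muln0.
pose P j := sval (constructive_indefinite_description _ (one j (count_mem j l))).
exists (\prod_j P j); apply: functional_extensionality => n.
rewrite /ev_mpoly rmorph_prod; apply: eq_bigr => j _.
exact: (svalP (constructive_indefinite_description _ (one j (count_mem j l)))).
Qed.

Lemma eventually_forall (Q : 'I_d -> deg d -> Prop) :
  (forall i, eventually (Q i)) -> eventually (fun n => forall i, Q i n).
Proof.
move=> ev; have : eventually (fun n => forall i, i \in enum 'I_d -> Q i n).
  elim: (enum 'I_d) => [|j r IH]; first by exists (dzero d).
  apply: eventually_mono (eventually_and (ev j) IH) => n [Qj Qr] i.
  by rewrite inE => /orP[/eqP -> //|]; exact: Qr.
by apply: eventually_mono => n h i; apply: h; rewrite mem_enum.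
Qed.

Lemma eventually_cst f : (forall i, eventually (fun n => Delta i f n = 0)) ->
  exists c, eventually (fun n => f n = c).
Proof.
move=> /eventually_forall [w wP]; exists (f w), w => n /dsubK <-.
move: (dsub n w) => p; move E: (\sum_i p i)%N => k; elim: k p E => [|k IH] p E.
  suff -> : p = dzero d by rewrite dadd0.
  apply/ffunP => i; rewrite ffunE; apply/eqP; rewrite -leqn0 -E.
  by rewrite (bigD1 i) //= leq_addr.
have [q [i [pE qE]]] := degree_pred E.
by rewrite pE daddA -(IH q qE); apply/eqP; rewrite -subr_eq0; apply/eqP/wP/dle_addr.
Qed.

(** For order [s + 1], all [s]-fold differences are eventually constant. Subtracting such a constant
    times [binoms l] for the lists [l] of [s] directions makes them vanish, and the induction
    handles the rest. *)
Lemma poly_below_mpoly s f : poly_below s f ->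
  exists P, eventually (fun n => f n = ev_mpoly P n).
Proof.
elim: s f => [|s IH] f fP.
  by exists 0; apply: eventually_mono fP => n ->; rewrite /ev_mpoly meval0.
suff [P Pl] : exists P : {mpoly rat[d]}, poly_below s (fun n => f n - ev_mpoly P n).
  have [Q Qev] := IH _ Pl; exists (Q + P); apply: eventually_mono Qev => n E.
  by rewrite /ev_mpoly mevalD -/(ev_mpoly Q n) -/(ev_mpoly P n) -E subrK.
(* The lists are treated one at a time. Differences already cancelled stay zero, since among the
   lists of size [s] only permutations of [l] see [binoms l]. *)
suff [P [_ Pl]] : exists P : {mpoly rat[d]}, poly_below s.+1 (fun n => f n - ev_mpoly P n) /\
    forall l, l \in map val (enum {: s.-tuple 'I_d}) ->
      eventually (fun n => Deltas l (fun n => f n - ev_mpoly P n) n = 0).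
  exists P; apply/poly_belowE => l /eqP sl; apply: Pl.
  by apply/mapP; exists (Tuple sl); rewrite // mem_enum.
have : forall l, l \in map val (enum {: s.-tuple 'I_d}) -> size l = s.
  by move=> _ /mapP[t _ ->]; exact: size_tuple.
elim: (map val _) => [_|l L IHL sL].
  exists 0; split=> //; apply: poly_below_ext fP; exists (dzero d) => n _.
  by rewrite /ev_mpoly meval0 subr0.
have [|P [gP gL]] := IHL; first by move=> l' l'L; apply: sL; rewrite inE l'L orbT.
set g := fun n => f n - ev_mpoly P n in gP gL.
have sl : size l = s by apply: sL; rewrite inE eqxx.
have [|c cev] := @eventually_cst (Deltas l g).
  by move=> i; apply: (poly_below_Deltas (l := i :: l) gP); rewrite /= sl.
have [Q QE] := binoms_mpoly l.
have gE : (fun n => f n - ev_mpoly (P + c%:MP * Q) n) = (fun n => g n - c * binoms l n).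
  apply: functional_extensionality => n; rewrite /g /ev_mpoly mevalD mevalM mevalC opprD addrA.
  by rewrite -QE.
have DE l' n : (s <= size l')%N -> Deltas l' (fun n => g n - c * binoms l n) n =
    Deltas l' g n - c * (if perm_eq l' l then 1 else 0).
  by move=> le; rewrite DeltasB DeltasZ Deltas_binoms // sl.
exists (P + c%:MP * Q); rewrite gE; split.
  apply/poly_belowE => l' sl'; have := poly_below_Deltas (l := l') gP; rewrite sl' => /(_ (leqnn _)).
  apply: eventually_mono => n E; rewrite DE ?sl' // E ifF ?mulr0 ?subr0 //.
  by apply/negP => /perm_size; rewrite sl sl' => /eqP; rewrite eqn_leq ltnn.
move=> l' l'L; have sl' := sL l' l'L.
have [p|np] := boolP (perm_eq l' l).
  rewrite (Deltas_perm _ p); apply: eventually_mono cev => n E.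
  by rewrite DE ?sl // perm_refl E mulr1 subrr.
move: l'L; rewrite inE => /orP[/eqP E|/gL]; first by rewrite E perm_refl in np.
by apply: eventually_mono => n E; rewrite DE ?sl' // E (negbTE np) mulr0 subr0.
Qed.

(** Any other monomial of degree at most [size l] has some exponent smaller than the number of
    differences in its direction, so it is killed. *)
Lemma Deltas_mpoly l (P : {mpoly rat[d]}) n :
  (forall m, m \in msupp P -> (mdeg m <= size l)%N) ->
  Deltas l (ev_mpoly P) n =
  ((\prod_j (count_mem j l)`!)%N)%:R * P@_[multinom count_mem j l | j < d].
Proof.
move=> degP; set k := [multinom _ | _ < _].
have -> : ev_mpoly P = fun n => \sum_(m <- msupp P) P@_m * \prod_j (n j)%:R ^+ m j.
  by apply: functional_extensionality => u; rewrite /ev_mpoly mevalE.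
rewrite Deltas_sum.
have E m : m \in msupp P -> Deltas l (fun n => P@_m * \prod_j (n j)%:R ^+ m j) n =
    P@_m * (if m == k then ((\prod_j (count_mem j l)`!)%N)%:R else 0).
  move=> /degP mP; rewrite DeltasZ (Deltas_prod l (fun j t => t%:R ^+ m j)); congr (_ * _).
  case: eqP => [->|mk].
    by rewrite natr_prod; apply: eq_bigr => j _; rewrite mnmE diff1_pow ?eqxx.
  have [lj cj] := exists_seq_count m.
  have szj : size lj = mdeg m.
    by rewrite mdegE size_sum_count; apply: eq_bigr => i _.
  have [||j] := @exists_count_lt lj l.
  - by rewrite szj.
  - by apply/negP => /permP p; apply: mk; apply/mnmP => j; rewrite mnmE p cj.
  rewrite cj => lt; rewrite (bigD1 j) //= diff1_pow 1?ltnW // ltn_eqF ?mul0r //.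
rewrite big_seq (eq_bigr _ E) -big_seq.
have [kP|kP] := boolP (k \in msupp P); last first.
  rewrite (memN_msupp_eq0 kP) mulr0 big_seq big1 // => m mP.
  by case: eqP mP kP => [-> ->|_ _ _]; rewrite ?mulr0.
rewrite (bigD1_seq k) ?msupp_uniq //= eqxx [X in _ + X]big1 ?addr0 1?mulrC // => m /negbTE ->.
by rewrite mulr0.
Qed.

(** If a monomial [m0] of largest degree had degree at least [s], the differences counted by [m0]
    would vanish eventually, yet they equal its coefficient times a product of factorials. *)
Lemma poly_below_mdeg s f (P : {mpoly rat[d]}) m : poly_below s f ->
  eventually (fun n => f n = ev_mpoly P n) -> m \in msupp P -> (mdeg m < s)%N.
Proof.
move=> fP fE mP.
have [m0 m0P max] : exists2 m0, m0 \in msupp P &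
    forall m, m \in msupp P -> (mdeg m <= mdeg m0)%N.
  elim: (msupp P) m mP => [//|a r IH] m _.
  have [->|] := eqVneq r [::].
    by exists a; rewrite ?inE // => b; rewrite inE => /eqP ->.
  case: r IH => // x r IH _; have [|b br bmax] := IH x; first by rewrite inE eqxx.
  have [le|lt] := leqP (mdeg a) (mdeg b).
    exists b => [|c]; first by rewrite in_cons br orbT.
    by rewrite in_cons => /orP[/eqP ->|/bmax].
  exists a => [|c]; first by rewrite in_cons eqxx.
  rewrite in_cons => /orP[/eqP -> //|/bmax le].
  exact: leq_trans le (ltnW lt).
apply: leq_ltn_trans (max m mP) _; rewrite ltnNge; apply/negP => le.
have [l lE] := exists_seq_count m0.
have szl : size l = mdeg m0.
  by rewrite mdegE size_sum_count; apply: eq_bigr => i _.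
have ev0 := poly_below_Deltas (l := l) fP; rewrite szl in ev0.
have := eventually_and (ev0 le) (Deltas_eventually l fE).
suff c0 : ((\prod_j (count_mem j l)`!)%N)%:R * P@_[multinom count_mem j l | j < d] != 0.
  move=> ev; case/eqP: c0; apply: (@eventually_const d).
  apply: eventually_mono ev => n [-> E]; rewrite E.
  by rewrite Deltas_mpoly // => m' /max; rewrite szl.
have -> : [multinom count_mem j l | j < d] = m0 by apply/mnmP => j; rewrite mnmE lE.
rewrite mulf_neq0 -?mcoeff_msupp // pnatr_eq0 -lt0n prodn_gt0 // => j.
exact: fact_gt0.
Qed.

End Differences.

(** * The Hilbert polynomial *)

Section HilbertPolynomial.
Variables (d : nat) (S : comNzRingType) (M : lmodType S).
Variables (Sg : deg d -> S -> Prop) (Mg : deg d -> M -> Prop).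
Hypotheses (hS : graded_ring Sg) (hMd : dirsum Mg).
Hypothesis hMs : forall m n a v, Sg m a -> Mg n v -> Mg (dadd m n) (a *: v).
Local Notation sc := (comp hS.1).
Local Notation mc := (comp hMd).
Local Notation B := (Sg (dzero d)).
Local Notation all_scal := (fun _ : S => True).
Hypothesis Sstd : generates B (fun s => exists i, Sg (dunit i) s).
Hypothesis nS : noeth all_scal (fun _ : S^o => True).
Hypothesis nM : noeth all_scal (fun _ : M => True).
Variable lB : nat.
Hypothesis finB : clen B (pzero : S^o -> Prop) B lB.
Local Notation len := (len Sg Mg).
Local Notation gsub := (gsub hMd).
Implicit Types (K L N H : M -> Prop) (P : S -> Prop) (m n e : deg d).

Lemma lenD N K H n : gsub N -> gsub K -> gsub H -> incl N K -> incl K H ->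
  len N H n = (len N K n + len K H n)%N.
Proof. exact: (len_add hS hMs nM finB). Qed.

Lemma len_eq0 N H n : gsub N -> gsub H -> incl N H -> (len N H n = 0%N <-> incl (part Mg n H) N).
Proof. exact: (len0 hS hMs nM finB). Qed.

Lemma len_mul e x N N' H n : Sg e x -> gsub N -> gsub N' -> gsub H -> incl N H ->
  (forall v, part Mg n H v -> N' (x *: v) <-> N v) ->
  len N' (psum (times x H) N') (dadd e n) = len N H n.
Proof. exact: (len_times hS hMs nM finB). Qed.

Lemma pchain_mono (X Y : (S -> Prop) -> Prop) c : incl X Y -> pchain X c -> pchain Y c.
Proof. by move=> XY [h1 h2]; split=> // j /h1/XY. Qed.

Lemma gsub_multiples_all m v : Mg m v -> gsub (multiples all_scal v).
Proof.
have iT : ideal all_scal by [].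
exact: (gsub_multiples (hS := hS) hMd hMs iT (fun _ _ _ => I)).
Qed.

Lemma gsub_multiples_prime P m v : homog_prime Sg P -> Mg m v -> gsub (multiples P v).
Proof.
move=> hP; apply: (gsub_multiples (hS := hS) hMd hMs hP.1) => n s.
exact: homog_prime_comp.
Qed.

(* For [N' = N + S v] with [v] homogeneous and [P] the annihilator of [v] modulo [N], the module
   [N' / N] is a shift of [S / P], so multiplication by [x] outside [P] is injective on it. *)
Lemma ann_mul_inj N v x : gsub N -> homog_prime Sg (ann N v) -> ~ ann N v x ->
  forall u, psum (multiples all_scal v) N u -> N (x *: u) <-> N u.
Proof.
move=> gN hP nx _ [_ [y [[s _ ->] Ny ->]]].
have [_ [_ [Ppr _]]] := hP.
split=> [Nxu|Nu]; last exact: (submodZ gN.1).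
apply: (submodD gN.1) => //.
have [//|] : ann N v x \/ ann N v s; last by [].
apply: Ppr; rewrite /ann -scalerA; apply: (submodDr gN.1 (y := x *: y)).
  by rewrite -scalerDr.
exact: (submodZ gN.1).
Qed.

(** [s] bounds the number of primes in a chain, one more than the dimension; thus [s = 0] means
    empty support. The outer induction on [s] treats [N'/N], the inner Noetherian one on [N] treats
    [H/N']. *)
Lemma len_poly_below s N H : gsub N -> gsub H -> incl N H ->
  (forall c, pchain (supp_quot Sg N H) c -> (size c <= s)%N) ->
  poly_below s (fun n => (len N H n)%:R).
Proof.
elim/ltn_ind: s N H => s IHs N H; move: N.
apply: (well_founded_ind (noeth_wf nM)) => N IHN gN gH NH chains.
have [HN|nHN] := classic (incl H N).
  apply: poly_below_zero; exists (dzero d) => n _.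
  by rewrite ((len_eq0 n gN gH NH).2) // => v [/HN].
have [m [v [mv Hv nNv hP]]] := exists_prime_ann hS hMs nS gN gH nHN.
pose P := ann N v; rewrite -/P in hP.
pose N' := psum (multiples all_scal v) N.
have gv := gsub_multiples_all mv.
have gN' : gsub N' by exact: gsub_psum.
have NN' : incl N N' := psum_inclr gv.1.
have N'H : incl N' H.
  by apply: (psum_least gH.1) => //; exact: (multiples_incl gH.1).
apply: (@poly_below_ext _ _ (fun n => (len N N' n)%:R + (len N' H n)%:R)).
  by exists (dzero d) => n _; rewrite (lenD n gN gN' gH NN' N'H) natrD.
apply: poly_belowD; last first.
  apply: IHN => //; last first.
    move=> c /(pchain_mono (supp_quot_mono NN' (@incl_refl _ H))); exact: chains.
  split; [by split=> //; exact: gN'.1|by split=> //; exact: gN.1|split=> //].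
  by exists v; split=> //; exact: (psum_incll gN.1 (ex_intro2 _ _ 1 I (esym (scale1r v)))).
have [irr|nirr] := classic (forall n : deg d, (forall i, (1 <= n i)%N) -> incl (Sg n) P).
  (* Beyond [m + (1,...,1)], elements of degree [n - m] lie in [P], so they send [v] into [N]. *)
  apply: poly_below_zero; exists (dadd m [ffun => 1%N]) => n le.
  rewrite ((len_eq0 n gN gN' NN').2) // => _ [[_ [y [[s' _ ->] Ny ->]]] Mu].
  rewrite -(comp_id hMd Mu) compD; apply: (submodD gN.1); last exact: gN.2.
  have E : dadd (dsub n m) m = n by rewrite daddC dsubK //; exact: dle_trans (dle_addr _ _) le.
  rewrite -E (mc_scal_homr hS hMd hMs _ _ mv).
  apply: (irr (dsub n m)); last exact: comp_hom.
  by move=> i; have := dsub_le le i; rewrite ffunE.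
have PX : supp_quot Sg N H P.
  by split=> //; split=> //; exists v => // s' nPs'.
have s_gt0 : (0 < s)%N.
  by apply: (chains [:: P]); split=> [j|//]; rewrite ltnS leqn0 => /eqP ->.
case: s s_gt0 IHs {IHN} chains => // s _ IHs chains i.
have [x [ix nPx]] := degree_one_notin_prime hS Sstd i hP nirr.
(* [N2/N] in degree [n + e_i] is a copy of [N'/N] in degree [n], so the difference of the length of
   [N'/N] is the length of [N'/N2], shifted. *)
pose N2 := psum (times x N') N.
have gx : gsub (times x N') by exact: (gsub_times hMs ix).
have gN2 : gsub N2 by exact: gsub_psum.
have N2N' : incl N2 N'.
  by apply: (psum_least gN'.1) => // _ [u N'u ->]; exact: (submodZ gN'.1).
have NN2 : incl N N2 := psum_inclr gx.1.
apply: (@poly_below_ext _ _ (fun n => (len N2 N' (dadd n (dunit i)))%:R)).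
  exists (dzero d) => n _; rewrite /Delta (lenD _ gN gN2 gN' NN2 N2N') natrD.
  rewrite [in X in X + _ - _]daddC (len_mul (N := N)) //; first by rewrite addrAC subrr add0r.
  by move=> u [N'u _]; exact: (ann_mul_inj gN hP nPx).
apply: (@poly_below_shift _ _ _ (fun n => (len N2 N' n)%:R)).
(* A prime in the support of [N'/N2] contains both [P] and [x], so [P] can be put in front of any
   chain there. *)
apply: IHs => // c [cX cS]; rewrite -ltnS; apply: (chains (P :: c)).
have sub Q : supp_quot Sg N2 N' Q -> sincl P Q.
  move=> [hQ [nQ [u N'u uQ]]]; split.
    move=> a Pa; apply: NNPP => nQa; apply: (uQ a nQa); apply: NN2.
    have [_ [y [[b _ ->] Ny ->]]] := N'u.
    rewrite scalerDr scalerA mulrC -scalerA.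
    by apply: (submodD gN.1); apply: (submodZ gN.1).
  exists x; split=> //; apply: NNPP => nQx; apply: (uQ x nQx).
  by apply: (psum_incll gN.1 (ex_intro2 _ _ u N'u erefl)).
split=> [[|j]|[|j]] /=; rewrite ?ltnS // => lt.
- exact: supp_quot_mono NN2 N'H _ (cX _ lt).
- exact: sub (cX _ lt).
- exact: cS.
Qed.

(* A chain [P0 < P1] in the support gives a factor [S / P0] of the module whose length strictly
   grows under multiplication by a homogeneous element of [P1] outside [P0]. *)
Lemma no_chain_of_bounded N b : gsub N ->
  eventually (fun n => len N (fun _ => True) n <= b)%N ->
  forall P0 P1, supp_quot Sg N (fun _ => True) P0 -> supp_quot Sg N (fun _ => True) P1 ->
  ~ sincl P0 P1.
Proof.
move=> gN bnd P0 P1 X0 X1 [P01 [y [P1y nP0y]]].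
have gT := gsub_full hMd.
have [m [v [mv _ annP]]] := supp_quot_hom gN gT X0.
have [hP0 [nP0 _]] := X0; have [hP1 [nP1 _]] := X1.
have [iP0 [_ [Ppr _]]] := hP0; have [iP1 _] := hP1.
have [e nP0e] : exists e, ~ P0 (sc e y).
  apply: NNPP => nex; apply: nP0y; rewrite (comp_expand hS.1 y).
  have [[P00 [PD _]] _] := iP0.
  by apply: (big_ind P0) => // n _; apply: NNPP => nP; apply: nex; exists n.
have P1e := homog_prime_comp hS e hP1 P1y.
have ey := comp_hom hS.1 e y; move: (sc e y) ey nP0e P1e => z ez nP0z P1z.
(* [ann N v] is only contained in [P0]; enlarging [N] to [P0 v + N] makes the factor below [H] an
   exact shift of [S/P0]. *)
pose span_by P := psum (multiples P v) N.
have gspan P : homog_prime Sg P -> gsub (span_by P).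
  by move=> hP; apply: gsub_psum gN; exact: gsub_multiples_prime mv.
pose H := psum (multiples all_scal v) N.
have gH : gsub H by apply: gsub_psum gN; exact: gsub_multiples_all mv.
have gN0 := gspan _ hP0.
have memP P s : homog_prime Sg P -> incl P0 P -> span_by P (s *: v) -> P s.
  move=> [[[_ [PD _]] _] _] P0P [_ [w [[a Pa ->] Nw sE]]].
  rewrite -(subrK a s); apply: PD => //; apply/P0P/annP.
  by rewrite /ann scalerBl sE addrC addKr.
have N0H : incl (span_by P0) H.
  by move=> _ [_ [w [[a _ ->] Nw ->]]]; exists (a *: v), w; split=> //; exists a.
have NN0 : incl N (span_by P0) := psum_inclr (gsub_multiples_prime hP0 mv).1.
have inj u : H u -> span_by P0 (z *: u) <-> span_by P0 u.
  move=> [_ [w [[a _ ->] Nw ->]]].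
  have N0w : span_by P0 w.
    exact: NN0.
  split=> [zu|]; last exact: (submodZ gN0.1).
  apply: (submodD gN0.1) => //.
  have : P0 (z * a).
    apply: memP => //; rewrite -scalerA; apply: (submodDr gN0.1 (y := z *: w)).
      by rewrite -scalerDr.
    exact: (submodZ gN0.1).
  by case/Ppr => // P0a; apply: (psum_incll gN.1); exists a.
have gz := gsub_times hMs ez gH.
pose N2 := psum (times z H) (span_by P0).
have gN2 : gsub N2 by exact: gsub_psum.
have N2H : incl N2 H.
  by apply: (psum_least gH.1) => // _ [u Hu ->]; exact: (submodZ gH.1).
have N0N2 : incl (span_by P0) N2 := psum_inclr gz.1.
(* The cokernel [H/N2] of multiplication by [z] is nonzero in degree [e + n]: [N2] lies in
   [P1 v + N], but [x v] does not when [x] of degree [e + n - m] is outside [P1]. *)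
have grow n : dle m n -> (len (span_by P0) H n < len (span_by P0) H (dadd e n))%N.
  have E : len (span_by P0) N2 (dadd e n) = len (span_by P0) H n.
    by apply: len_mul => // u [Hu _]; exact: inj.
  move=> mn; rewrite (lenD (dadd e n) gN0 gN2 gH N0N2 N2H) E.
  rewrite -[X in (X < _)%N]addn0 ltn_add2l lt0n; apply/eqP => /(len_eq0 _ gN2 gH N2H) le.
  have [x [xdeg nP1x]] := hom_notin_prime hS Sstd (dsub (dadd e n) m) hP1 nP1.
  apply: nP1x; apply: memP => //.
  have N2P1 : incl N2 (span_by P1).
    have gN1 := gspan _ hP1.
    apply: (psum_least gN1.1).
      move=> _ [_ [_ [w [[a _ ->] Nw ->]]] ->]; exists (z *: (a *: v)), (z *: w).
      rewrite scalerDr; split=> //; last exact: (submodZ gN.1).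
      by exists (z * a); rewrite ?scalerA // mulrC; exact: iP1.2.
    move=> _ [_ [w [[a P0a ->] Nw ->]]]; exists (a *: v), w; split=> //.
    by exists a => //; exact: P01.
  apply: N2P1; apply: le; split.
    by apply: (psum_incll gN.1); exists x.
  have -> : dadd e n = dadd (dsub (dadd e n) m) m.
    by rewrite [RHS]daddC dsubK //; exact: dle_trans mn (dle_addl _ _).
  exact: hMs.
have unb k : eventually (fun n => k <= len (span_by P0) H n)%N.
  elim: k => [|k IHk]; first by exists (dzero d).
  apply: (@eventually_unshift _ e).
  have := eventually_and IHk (ex_intro _ m (fun n h => h) : eventually (dle m)).
  by apply: eventually_mono => n [le mn]; rewrite daddC; apply: leq_ltn_trans le (grow n mn).
have : eventually (fun _ : deg d => False); last exact: eventually_const.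
apply: eventually_mono (eventually_and bnd (unb b.+1)) => n [].
rewrite (lenD n gN gH gT) // ?(lenD n gN gN0 gH) //; last exact: incl_trans N0H.
move=> le gt; have := leq_trans gt (leq_trans (leq_addl _ _) (leq_trans (leq_addr _ _) le)).
by rewrite ltnn.
Qed.

(** With [ann N v] inside [P], the element [x v] is outside [N] for every [x] outside [P], and such
    [x] exist in every degree. *)
Lemma len_eventually_pos N P : gsub N -> supp_quot Sg N (fun _ => True) P ->
  ~ eventually (fun n => len N (fun _ => True) n = 0%N).
Proof.
move=> gN X [w wP]; have gT := gsub_full hMd.
have [m [v [mv _ annP]]] := supp_quot_hom gN gT X.
have [hP [nP _]] := X; have [x [wx nPx]] := hom_notin_prime hS Sstd w hP nP.
apply/nPx/annP/(len_eq0 (dadd w m) gN gT _).1; first exact: (fun _ _ => I).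
  exact/wP/dle_addr.
by split=> //; exact: hMs.
Qed.

Lemma qlength_len N n : gsub N -> qlength Sg N (Mg n) (len N (fun _ => True) n).
Proof.
move=> gN; apply: qlength_clen; first exact: submod_part.
have partT : part Mg n (fun _ => True) = Mg n by apply: predext => v; [case|split].
have := lenP hS hMs nM finB n gN (gsub_full hMd) (fun _ _ => I).
by rewrite partT.
Qed.

(** * Quotients by filter-regular sequences *)

Lemma gen_sub_nil : gen_sub (M := M) [::] = pzero.
Proof.
apply: predext => v; first by case=> ms [_ ->]; rewrite big_ord0.
by move=> ->; exists [::]; rewrite big_ord0.
Qed.

Lemma gen_sub_rcons (ys : seq S) y :
  gen_sub (M := M) (rcons ys y) = psum (times y (fun _ => True)) (gen_sub ys).
Proof.
have sumE (ms : seq M) (m : M) : size ms = size ys ->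
    \sum_(j < size (rcons ys y)) (rcons ys y)`_j *: (rcons ms m)`_j =
    \sum_(j < size ys) ys`_j *: ms`_j + y *: m.
  move=> sz; rewrite size_rcons big_ord_recr /= !nth_rcons sz ltnn eqxx; congr (_ + _).
  by apply: eq_bigr => j _; rewrite !nth_rcons sz ltn_ord.
apply: predext => v.
  case=> ms' [sz' ->]; case/lastP: ms' sz' => [|ms m] sz'; first by rewrite size_rcons in sz'.
  have sz : size ms = size ys by apply: succn_inj; rewrite -(size_rcons ms m) sz' size_rcons.
  rewrite sumE // addrC.
  by exists (y *: m), (\sum_(j < size ys) ys`_j *: ms`_j); split=> //; [exists m|exists ms].
case=> _ [_ [[m _ ->] [ms [sz ->]] ->]].
by exists (rcons ms m); rewrite sumE // addrC !size_rcons sz.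
Qed.

Lemma len_filter_regular N i x : gsub N -> Sg (dunit i) x -> filter_regular Sg Mg N x ->
  eventually (fun n =>
    (len (psum (times x (fun _ => True)) N) (fun _ => True) (dadd n (dunit i)))%:R = Delta i (fun n => (len N (fun _ => True) n)%:R) n).
Proof.
move=> gN ix [w reg]; have gT := gsub_full hMd.
have gx : gsub (times x (fun _ => True)) := gsub_times hMs ix gT.
have gN' := gsub_psum gx gN.
exists w => n wn; rewrite /Delta [dadd n _]daddC.
have NT (K : M -> Prop) : incl K (fun _ => True) by [].
rewrite (lenD _ gN gN' gT (psum_inclr gx.1) (NT _)) natrD (len_mul (N := N)) //.
  by rewrite addrAC subrr add0r.
move=> v [_ Mv]; split=> [|Nv]; first exact: reg Mv.
exact: (submodZ gN.1).
Qed.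

(** Each element contributes its unit vector to the shift [p]. The list is reversed because [Deltas]
    applies its head last, while the sequence grows at its end. *)
Lemma len_filter_regular_seq (xs : seq ('I_d * S)) :
  (forall p, p \in xs -> Sg (dunit p.1) p.2) ->
  (forall j, (j < size xs)%N ->
     filter_regular Sg Mg (gen_sub (M := M) (take j (map snd xs))) (nth 0 (map snd xs) j)) ->
  gsub (gen_sub (map snd xs)) /\
  exists p, eventually (fun n => (len (gen_sub (map snd xs)) (fun _ => True) (dadd n p))%:R =
    Deltas (rev (map fst xs)) (fun n => (len pzero (fun _ => True) n)%:R) n).
Proof.
elim/last_ind: xs => [_ _|xs [i x] IH degx reg].
  rewrite gen_sub_nil; split; first exact: gsub_zero.
  by exists (dzero d), (dzero d) => n _; rewrite dadd0.
have [||gN [p pE]] := IH.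
- by move=> q qxs; apply: degx; rewrite mem_rcons inE qxs orbT.
- move=> j lt; have := reg j; rewrite size_rcons map_rcons => /(_ (ltnW lt)).
  by rewrite nth_rcons size_map lt -cats1 takel_cat // size_map ltnW.
have ix : Sg (dunit i) x by apply: (degx (i, x)); rewrite mem_rcons inE eqxx.
have := reg (size xs); rewrite size_rcons map_rcons => /(_ (leqnn _)).
rewrite nth_rcons size_map ltnn eqxx -cats1 takel_cat ?size_map // take_oversize ?size_map //=.
move=> regx; have step := len_filter_regular gN ix regx.
rewrite cats1 gen_sub_rcons map_rcons rev_rcons /=; split.
  by apply: gsub_psum gN; exact: (gsub_times hMs ix (gsub_full hMd)).
exists (dadd p (dunit i)).
have := eventually_and (eventually_shift p step) (eventually_and pE (eventually_shift (dunit i) pE)).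
apply: eventually_mono => n [E [E1 E2]].
rewrite daddA E /Delta -E1 -E2; congr (_%:R - _).
by rewrite -!daddA [dadd p _]daddC.
Qed.

End HilbertPolynomial.

Theorem theorem2p4 (d : nat) (S : comNzRingType) (M : lmodType S)
  (Sg : deg d -> S -> Prop) (Mg : deg d -> M -> Prop)
  (hA : artinian_local_infres Sg)
  (hS : fg_standard Sg)
  (hM : fg_graded_module Sg Mg)
  (hrad : S1_not_in_rad_ann M Sg)
  (k : deg d)
  (hk : dim_eq (supp_pp Sg (gen_sub (M:=M) [::])) (dabs k))
  (xs : seq ('I_d * S))
  (hxdeg : forall p, p \in xs -> Sg (dunit p.1) p.2)
  (hxcount : forall i, count (fun p => p.1 == i) xs = k i)
  (hxreg : forall j, (j < size xs)%N ->
     filter_regular Sg Mg (gen_sub (M:=M) (take j (map snd xs))) (nth 0 (map snd xs) j)) :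
  (exists P, hilbert_poly Sg Mg P) /\
  forall P, hilbert_poly Sg Mg P ->
    (exists w : deg d, forall n, dle w n -> exists l : nat,
        qlength Sg (gen_sub (M:=M) (map snd xs)) (Mg n) l /\ (l%:R : rat) = mixed_mult P k) /\
    (mixed_mult P k != 0 <-> dim_eq (supp_pp Sg (gen_sub (M:=M) (map snd xs))) 0).
Proof.
have [hSg [Sstd [gs gsgen]]] := hS; have [hMd [hMs [ms msgen]]] := hM.
have B1 := scalB1 hSg; have BB := scalBB hSg; have BM := scalBM hSg.
have [dcc [mm [mmI [mm1 [mm_max _]]]]] := hA.
have [lB finB] : exists l, clen (Sg (dzero d)) (pzero : S^o -> Prop) (Sg (dzero d)) l.
  apply: (artinian_ideal_finite_length B1 BB BM dcc mmI mm1 mm_max).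
  by split=> //; exact: submod_scal.
have nM := noeth_fg B1 BB BM finB gsgen msgen.
have nS : noeth (fun _ : S => True) (fun _ : S^o => True).
  apply: (noeth_fg B1 BB BM finB gsgen (ms := [:: 1 : S^o])) => s.
  by exists [:: s]; rewrite big_ord1 /= /GRing.scale /= mulr1.
have gT := gsub_full hMd; have g0 := gsub_zero hMd.
have NT (K : M -> Prop) : incl K (fun _ => True) by [].
set T := fun _ : M => True in gT NT.
pose f n : rat := (len Sg Mg pzero T n)%:R.
(* Dimension [|k|] allows chains of [|k| + 1] primes, so the total degree is at most [|k|]. *)
have fP : poly_below (dabs k).+1 f.
  apply: (len_poly_below hSg hMs Sstd nS nM finB g0 gT (NT _)) => c.
  by rewrite supp_quot_pp -gen_sub_nil; exact: hk.2.
have qlen N n gN := @qlength_len _ _ _ _ _ hSg hMd hMs nM _ finB N n gN.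
split.
  have [P [w wP]] := poly_below_mpoly fP; exists P, w => n wn.
  by exists (len Sg Mg pzero T n); rewrite gen_sub_nil; split; [exact: qlen|exact: wP].
move=> P [w wP].
(* Uniqueness of [qlength] ties an arbitrary Hilbert polynomial [P] to the chosen length
   function. *)
have fE : eventually (fun n => f n = ev_mpoly P n).
  exists w => n /wP [l [ql lE]]; rewrite /ev_mpoly -lE /f; congr _%:R.
  by apply: qlength_uniq ql; rewrite gen_sub_nil; exact: qlen.
have [gN [p pE]] := len_filter_regular_seq hSg hMd hMs nM finB hxdeg hxreg.
set N := gen_sub _ in gN pE *.
have cE i : count_mem i (rev (map fst xs)) = k i.
  by rewrite count_rev count_map -hxcount.
have size_l : size (rev (map fst xs)) = dabs k.
  by rewrite size_sum_count; apply: eq_bigr.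
have lenE : eventually (fun n => (len Sg Mg N T n)%:R = mixed_mult P k).
  apply: (@eventually_unshift _ p).
  apply: eventually_mono (eventually_and pE (Deltas_eventually (rev (map fst xs)) fE)) => n [-> ->].
  rewrite Deltas_mpoly => [|m mP]; last first.
    by rewrite size_l -ltnS; exact: poly_below_mdeg fP fE mP.
  rewrite /mixed_mult; congr (_%:R * P@_ _); first by apply: eq_bigr => i _; rewrite cE.
  by apply/mnmP => i; rewrite !mnmE cE.
split.
  have [v vE] := lenE; exists v => n vn; exists (len Sg Mg N T n).
  by split; [exact: qlen|exact: vE].
rewrite -supp_quot_pp; split=> [e0|[[c [[cX _] sc]] _]]; last first.
  apply/eqP => e0; apply: (len_eventually_pos hSg hMs Sstd nM finB gN (cX 0%N _)); first by rewrite sc.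
  apply: eventually_mono lenE => n; rewrite e0 => /eqP; by rewrite pnatr_eq0 => /eqP.
split.
  apply: NNPP => nex; case/eqP: e0; apply: (@eventually_const d).
  (* If the support were empty, the case [s = 0] would make the length vanish eventually, and with
     it the constant. *)
  have : poly_below 0 (fun n => (len Sg Mg N T n)%:R).
    apply: (len_poly_below hSg hMs Sstd nS nM finB gN gT (NT _)) => -[//|P0 c] [cX _].
    case: nex; exists [:: P0]; split=> //; split=> [j|//].
    by rewrite ltnS leqn0 => /eqP ->; exact: (cX 0%N).
  by move/(eventually_and lenE); apply: eventually_mono => n [<-].
case=> [//|P0 [//|P1 c]] [cX cS]; exfalso.
have [v vE] := lenE.
(* From [v] on the length is constant, so its value at [v] serves as the bound. *)
apply: (no_chain_of_bounded hSg hMs Sstd nM finB (b := len Sg Mg N T v) gN _ (cX 0%N isT) (cX 1%N isT)).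
  exists v => n vn; suff -> : len Sg Mg N T n = len Sg Mg N T v by [].
  by apply/eqP; rewrite -(eqr_nat rat) vE // vE //; exact: dle_refl.
exact: (cS 0%N isT).
Qed.
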